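(* Let $0<p<1$, $0<\varepsilon<1$, and let $\mathbb{Q}$ be the law on $\{-1,1\}^{\mathbb{Z}_+}$ of the hidden Markov process $Y_n=X_n\cdot Z_n$, where $\{X_n\}$ is the stationary symmetric $\{\pm1\}$-valued Markov chain with $\mathbb{P}(X_{n+1}\neq X_n)=p$ and $\{Z_n\}$ is an independent i.i.d. sequence with $\mathbb{P}_Z(Z_n=-1)=\varepsilon$, $\mathbb{P}_Z(Z_n=1)=1-\varepsilon$. Put $$J=\tfrac12\log\tfrac{1-p}{p},\quad K=\tfrac12\log\tfrac{1-\varepsilon}{\varepsilon},\quad \lambda_{J,K}=4\cosh(J)\cosh(K),$$ $$A(w)=\tfrac12\log\frac{\cosh(w+J)}{\cosh(w-J)},\qquad B(w)=\tfrac12\log\bigl[4\cosh(w+J)\cosh(w-J)\bigr],\qquad w\in\mathbb{R}.$$ For $\boldsymbol y\in\{-1,1\}^{\mathbb{Z}_+}$ and $n\in\mathbb{Z}_+$ let $w_i^{(n)}(\boldsymbol y)=0$ for $i\ge n+1$ and $w_i^{(n)}(\boldsymbol y)=Ky_i+A(w_{i+1}^{(n)}(\boldsymbol y))$ for $0\le i\le n$, and let $w_i(\boldsymbol y)=\lim_{n\to\infty}w_i^{(n)}(\boldsymbol y)$ (this limit exists). Then $\mathbb{Q}$ is a $g$-measure for the function $$g(\boldsymbol y)=\frac{1}{\lambda_{J,K}}\,\frac{\cosh(w_0(\boldsymbol y))\exp\bigl(B(w_1(\boldsymbol y))\bigr)}{\cosh(w_1(\boldsymbol y))},$$ and $\mathbb{Q}$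 is both an equilibrium state and a Bowen-Gibbs measure, with constant $P=\log\lambda_{J,K}$, for the potential $$\phi(\boldsymbol y)=B(w_0(\boldsymbol y))=\tfrac12\log\Bigl[4\sinh^2(w_0(\boldsymbol y))+\frac1{p(1-p)}\Bigr].$$
   Context: $\mathbb{Z}_+=\{0,1,2,\dots\}$. The chain $\{X_n\}$ has uniform stationary distribution and transition probabilities $p_{x,x'}=p$ if $x\ne x'$ and $1-p$ if $x=x'$. Explicitly, for $y_0,\dots,y_n\in\{-1,1\}$, $$\mathbb{Q}(Y_0=y_0,\dots,Y_n=y_n)=\sum_{x_0,\dots,x_n\in\{-1,1\}}\frac12\prod_{i=0}^{n-1}p_{x_i,x_{i+1}}\cdot \varepsilon^{\#\{0\le i\le n:\,x_iy_i=-1\}}(1-\varepsilon)^{\#\{0\le i\le n:\,x_iy_i=1\}} .$$ Let $\Omega=A_0^{\mathbb{Z}_+}$ with $A_0$ a finite alphabet (here $A_0=\{-1,1\}$), with the product topology and left shift $S:\Omega\to\Omega$, $(S\boldsymbol\omega)_i=\omega_{i+1}$. A fully supported translation invariant Borel probability measure $\mathbb{P}$ on $\Omega$ is a $g$-measure for a positive continuous $g:\Omega\to(0,1)$ if $\sum_{\bar\omega_0\in A_0}g(\bar\omega_0,\omega_1,\omega_2,\dots)=1$ for all $\boldsymbol\omega\in\Omega$ and $\mathbb{P}(\omega_0\mid\omega_1,\omega_2,\dots)=g(\omega_0,\omega_1,\dots)$ for $\mathbb{P}$-a.a. $\boldsymbol\omega$. Such a measure $\mathbb{P}$ is Bowen-Gibbs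 for a continuous potential $\phi:\Omega\to\mathbb{R}$ with constant $P\in\mathbb{R}$ if there exists $C\ge1$ such that for all $\boldsymbol\omega\in\Omega$ and all $n\in\mathbb{N}$, $n\ge1$, $$\frac1C\le\frac{\mathbb{P}(\{\tilde{\boldsymbol\omega}:\tilde\omega_0=\omega_0,\dots,\tilde\omega_{n-1}=\omega_{n-1}\})}{\exp\bigl(\sum_{k=0}^{n-1}\phi(S^k\boldsymbol\omega)-nP\bigr)}\le C .$$ It is an equilibrium state for a continuous $\phi$ if $h(\mathbb{P})+\int\phi\,d\mathbb{P}=\sup_{\tilde{\mathbb{P}}}\bigl[h(\tilde{\mathbb{P}})+\int\phi\,d\tilde{\mathbb{P}}\bigr]$, where $h$ is the Kolmogorov-Sinai entropy with respect to $S$ and the supremum is over all translation invariant Borel probability measures on $\Omega$. *)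

(* Defs.v *)
From HB Require Import structures.
From mathcomp Require Import all_boot all_order all_algebra.
From mathcomp Require Import all_classical all_reals all_analysis.

Set Implicit Arguments.
Unset Strict Implicit.
Unset Printing Implicit Defensive.

Import Order.TTheory GRing.Theory Num.Theory.
Import numFieldNormedType.Exports.

Local Open Scope classical_set_scope.
Local Open Scope ring_scope.

(* The alphabet {-1, 1} is represented by bool (discrete topology), read
   through b |-> (-1)^b: false stands for 1 and true for -1. *)
Definition spin {R : realType} (b : bool) : R := (-1) ^+ b.

Definition Omega : Type := {ptws nat -> bool}.
HB.instance Definition _ := Pointed.on Omega.
HB.instance Definition _ := Uniform.on Omega.

Definition Omega_display : measure_display := sigma_display (@open Omega).
HB.instance Definition _ := @isMeasurable.Build Omega_display Omega
  <<s (@open Omega) >> (@sigma_algebra0 _ setT open)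
  (@sigma_algebraC Omega open) (@sigma_algebra_bigcup _ setT open).

Definition shift (w : Omega) : Omega := fun i => w i.+1.

Definition scons (a : bool) (w : Omega) : Omega :=
  fun i => if i is j.+1 then w j else a.

Definition cylinder (n : nat) (w : Omega) : set Omega :=
  [set v | forall i, (i < n)%N -> v i = w i].

Definition shift_invariant (R : realType) (P : probability Omega R) : Prop :=
  forall B : set Omega, measurable B -> P (shift @^-1` B) = P B.

Definition fully_supported (R : realType) (P : probability Omega R) : Prop :=
  forall U : set Omega, open U -> U !=set0 -> (0 < P U)%E.

(* q is a version of the conditional probability P(E | F), for a
   sub-sigma-algebra F. *)
Definition is_cond_prob (R : realType) (d : measure_display)
    (T : measurableType d) (P : probability T R) (F : set (set T))
    (E : set T) (q : T -> R) : Prop :=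
  [/\ forall U : set R, measurable U -> F (q @^-1` U),
      P.-integrable setT (EFin \o q) &
      forall B, F B -> P (E `&` B) = (\int[P]_(t in B) (q t)%:E)%E].

(* The sigma-algebra generated by the coordinates w 1, w 2, ... *)
Definition sigma_future : set (set Omega) :=
  <<s [set A | exists (i : nat) (a : bool),
                 (0 < i)%N /\ A = [set w : Omega | w i = a]] >>.

(* P(w_0 | w_1, w_2, ...) is the random variable that equals
   P(first letter = a | w_1, w_2, ...) on the event w_0 = a. *)
Definition is_g_measure (R : realType) (P : probability Omega R)
    (g : Omega -> R) : Prop :=
  [/\ fully_supported P /\ shift_invariant P,
      continuous g,
      forall w, 0 < g w < 1,
      forall w, \sum_(a : bool) g (scons a (shift w)) = 1 &
      exists q : bool -> Omega -> R,
        (forall a, is_cond_prob P sigma_future [set w | w 0%N = a] (q a)) /\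
        {ae P, forall w, q (w 0%N) w = g w}].

Definition is_bowen_gibbs (R : realType) (P : probability Omega R)
    (phi : Omega -> R) (pressure : R) : Prop :=
  [/\ fully_supported P, shift_invariant P, continuous phi &
      exists2 C : R, 1 <= C &
        forall (w : Omega) (n : nat), (1 <= n)%N ->
          C^-1 <= fine (P (cylinder n w)) /
                  expR (\sum_(k < n) phi (iter k shift w) - n%:R * pressure)
               <= C].

(* A finite measurable partition of T is given by its labelling function
   xi : T -> 'I_k. The event that the labels of t, S t, ..., S^(n-1) t spell the
   word c is an atom of the join of the S^(-i) xi, 0 <= i < n. Recall that
   ln 0 = 0, so that empty and null atoms contribute 0. *)
Definition join_entropy (R : realType) (d : measure_display)
    (T : measurableType d) (P : probability T R) (S : T -> T)
    (k : nat) (xi : T -> 'I_k) (n : nat) : R :=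
  \sum_(c : {ffun 'I_n -> 'I_k})
    let m := fine (P [set t | forall i : 'I_n, xi (iter i S t) = c i]) in
    - (m * ln m).

Definition partition_entropy (R : realType) (d : measure_display)
    (T : measurableType d) (P : probability T R) (S : T -> T)
    (k : nat) (xi : T -> 'I_k) : R :=
  limn (fun n => join_entropy P S xi n / n%:R).

(* Kolmogorov-Sinai entropy *)
Definition KS_entropy (R : realType) (d : measure_display)
    (T : measurableType d) (P : probability T R) (S : T -> T) : \bar R :=
  ereal_sup [set h | exists (k : nat) (xi : T -> 'I_k),
    (forall i, measurable (xi @^-1` [set i])) /\
    h = (partition_entropy P S xi)%:E].

Definition free_energy (R : realType) (phi : Omega -> R)
    (P : probability Omega R) : \bar R :=
  (KS_entropy P shift + \int[P]_w (phi w)%:E)%E.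

Definition is_equilibrium_state (R : realType) (P : probability Omega R)
    (phi : Omega -> R) : Prop :=
  [/\ continuous phi, shift_invariant P &
      free_energy phi P =
      ereal_sup [set free_energy phi P' | P' in @shift_invariant R]].

Definition trajectory (T : Type) (X : nat -> T -> bool) (t : T) : Omega :=
  fun n => X n t.

Definition transition (R : realType) (p : R) (x x' : bool) : R :=
  if x == x' then 1 - p else p.

(* The stationary Markov chain with transition matrix [transition p], started
   from the uniform distribution, through its finite-dimensional laws. *)
Definition is_symmetric_chain (R : realType) (d : measure_display)
    (T : measurableType d) (P : probability T R) (p : R)
    (X : nat -> T -> bool) : Prop :=
  forall (n : nat) (x : nat -> bool),
    P [set t | forall i, (i <= n)%N -> X i t = x i] =
    (2^-1 * \prod_(i < n) transition p (x i) (x i.+1))%:E.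

Definition mutually_independent (R : realType) (d : measure_display)
    (T : measurableType d) (P : probability T R)
    (Z : nat -> T -> bool) : Prop :=
  forall (s : seq nat) (B : nat -> set bool), uniq s ->
    P [set t | forall i, i \in s -> B i (Z i t)] =
    (\prod_(i <- s) P (Z i @^-1` B i))%E.

Definition independent_processes (R : realType) (d : measure_display)
    (T : measurableType d) (P : probability T R)
    (X Z : nat -> T -> bool) : Prop :=
  forall A B : set Omega, measurable A -> measurable B ->
    P (trajectory X @^-1` A `&` trajectory Z @^-1` B) =
    (P (trajectory X @^-1` A) * P (trajectory Z @^-1` B))%E.

Definition is_law (R : realType) (d : measure_display) (T : measurableType d)
    (P : probability T R) (Y : nat -> T -> bool)
    (Q : probability Omega R) : Prop :=
  forall B : set Omega, measurable B -> Q B = P (trajectory Y @^-1` B).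

Definition cosh {R : realType} (x : R) : R := (expR x + expR (- x)) / 2.
Definition sinh {R : realType} (x : R) : R := (expR x - expR (- x)) / 2.

Definition lambda {R : realType} (J K : R) : R := 4 * cosh J * cosh K.

Definition Afun {R : realType} (J w : R) : R :=
  2^-1 * ln (cosh (w + J) / cosh (w - J)).

Definition Bfun {R : realType} (J w : R) : R :=
  2^-1 * ln (4 * cosh (w + J) * cosh (w - J)).

(* m nested steps of the recursion, starting at index i. *)
Fixpoint field_iter {R : realType} (J K : R) (y : Omega) (m i : nat) : R :=
  if m is m'.+1 then K * spin (y i) + Afun J (field_iter J K y m' i.+1) else 0.

Definition field_n {R : realType} (J K : R) (y : Omega) (n i : nat) : R :=
  field_iter J K y (n.+1 - i) i.

(* field_n J K y n i is w_i^(n)(y): it satisfies the two defining equations. *)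
Lemma field_n_out (R : realType) (J K : R) (y : Omega) (n i : nat) :
  (n.+1 <= i)%N -> field_n J K y n i = 0.
Proof. by rewrite /field_n -subn_eq0 => /eqP ->. Qed.

Lemma field_n_rec (R : realType) (J K : R) (y : Omega) (n i : nat) :
  (i <= n)%N ->
  field_n J K y n i = K * spin (y i) + Afun J (field_n J K y n i.+1).
Proof. by move=> le_in; rewrite /field_n subSn //= subSS. Qed.

Definition field {R : realType} (J K : R) (y : Omega) (i : nat) : R :=
  limn (fun n => field_n J K y n i).

(* Main.v *)
(* The letters of the hidden chain can be summed out from the last one to the
   first: a spin that feels a field w contributes
   sum_x exp ((w + J s) x) = exp (B w + A w s) to its left neighbour s, so that
   Q [y_0 ... y_(n-1)] = lambda^-n cosh (w_0) prod_(1 <= i <= n) exp (B w_i),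
   where w_i is the field computed from y_i, ..., y_(n-1).  As A is a
   contraction, w_i is exponentially close to its limit.  Hence the Bowen-Gibbs
   bounds, and the conditional probability of y_0 given y_1, ..., y_n, which is a
   ratio of two such weights, converges uniformly to g.
   For the variational principle, put phi = B w_0.  Gibbs' inequality bounds the
   entropy of any invariant P, on a partition xi, by the mean code length of a
   code that gives the word y_0 ... y_(n+m-1) its Q-weight and then corrects the
   xi-names predicted from m letters; xi is almost determined by finitely many
   letters, so the corrections are cheap and h(P) + int phi dP <= log lambda.
   For P = Q the coordinate partition attains this bound. *)
From HB Require Import structures.
Require Import Defs.
From mathcomp Require Import all_boot all_order all_algebra.
From mathcomp Require Import all_classical all_reals all_analysis.
From mathcomp Require Import measurable_realfun ring lra zify.

Set Implicit Arguments.
Unset Strict Implicit.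
Unset Printing Implicit Defensive.

Import Order.TTheory GRing.Theory Num.Theory.
Import numFieldNormedType.Exports.

Local Open Scope classical_set_scope.
Local Open Scope ring_scope.

(** The half log-odds [J] and [K] turn transition and noise probabilities into exp (J x x') / (2
    cosh J) and exp (K x y) / (2 cosh K), so Q is the marginal of an Ising chain, and A is a
    contraction because its derivative is at most |tanh J| < 1 in modulus. The conditional
    probability is identified without a limit theorem for conditional expectations: two finite
    measures agree when their ratio on n-cylinders is squeezed between factors tending to 1, since
    additivity carries each bound to all shorter cylinders. The entropy is a supremum over all
    finite measurable partitions, and [limn] does not say that a limit exists. Hence each partition
    is bounded for all large n, up to an arbitrary e. The code mixes the predicted label with a
    uniform law of weight d, which makes a wrong prediction finitely expensive. The value of d has
    to be fixed before the approximating partition, whose error is then taken small compared with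
    that expense. *)

Local Notation shift := Defs.shift.

(** * Hyperbolic identities and the Lipschitz constants of A, B and ln cosh *)

Section hyperbolic.
Variable R : realType.
Implicit Types x y w J : R.

Lemma cosh_gt0 x : 0 < cosh x.
Proof. by rewrite /cosh divr_gt0 // addr_gt0 ?expR_gt0. Qed.

Lemma coshN x : cosh (- x) = cosh x.
Proof. by rewrite /cosh opprK addrC. Qed.

Lemma cosh0 : cosh 0 = 1 :> R.
Proof. by rewrite /cosh oppr0 expR0; field. Qed.

(** Used twice: it bounds the derivative of A, and it gives the closed form of the potential with 1
    / (p (1 - p)). *)
Lemma cosh_addM_sub w J :
  cosh (w + J) * cosh (w - J) = sinh w ^+ 2 + cosh J ^+ 2.
Proof.
rewrite /cosh /sinh !opprD !opprK !expRD !expRN.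
have := gt_eqF (expR_gt0 w); have := gt_eqF (expR_gt0 J).
by move=> /negbT fJ /negbT fw; field; rewrite fJ fw.
Qed.

Lemma cosh_add_sub w J :
  cosh (w + J) + cosh (w - J) = 2 * cosh w * cosh J.
Proof. by rewrite /cosh !opprD !opprK !expRD; field. Qed.

Lemma sinh_mul_sub w J :
  sinh (w + J) * cosh (w - J) - sinh (w - J) * cosh (w + J) =
  2 * sinh J * cosh J.
Proof.
rewrite /cosh /sinh !opprD !opprK !expRD !expRN.
have := gt_eqF (expR_gt0 w); have := gt_eqF (expR_gt0 J).
by move=> /negbT fJ /negbT fw; field; rewrite fJ fw.
Qed.

Lemma normr_sinh_lt x : `|sinh x| < cosh x.
Proof.
rewrite /cosh /sinh ltr_norml; have := expR_gt0 x; have := expR_gt0 (- x).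
by move=> ? ?; apply/andP; split; lra.
Qed.

Lemma is_derive_lncosh x :
  is_derive x 1 (fun x => ln (cosh x)) (sinh x / cosh x).
Proof.
have d1 : is_derive x (1 : R) (fun x => cosh x) (sinh x).
  rewrite /cosh /sinh.
  have dN : is_derive x (1 : R) (expR \o -%R) (expR (- x) * (- 1)).
    by apply: is_derive1_comp.
  have -> : (fun x => (expR x + expR (- x)) / 2) =
            2^-1 \*: (expR \+ (expR \o -%R)) :> (R -> R).
    by apply/funext => z /=; rewrite mulrC.
  apply: is_derive_eq.
  by rewrite [LHS]mulrC mulrN1.
have d2 : is_derive (cosh x) 1 (@ln R) (cosh x)^-1.
  by apply: is_derive1_ln; exact: cosh_gt0.
have := is_derive1_comp d2 d1.
by rewrite mulrC.
Qed.

Lemma is_derive_lncoshD c x :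
  is_derive x 1 (fun x => ln (cosh (x + c))) (sinh (x + c) / cosh (x + c)).
Proof.
have d1 : is_derive x (1 : R) (fun x => x + c) 1.
  by apply: is_derive_eq; rewrite addr0.
have := @is_derive1_comp _ _ (fun x => x + c) _ _ _ (is_derive_lncosh (x + c)) d1.
by rewrite mulr1.
Qed.

Lemma lipschitz_derive (f df : R -> R) (c : R) :
  (forall x, is_derive x 1 f (df x)) -> (forall x, `|df x| <= c) ->
  forall x y, `|f x - f y| <= c * `|x - y|.
Proof.
move=> fdf dfc x y.
wlog lexy : x y / x <= y => [h|].
  by case: (leP x y) => [/h//|/ltW/h]; rewrite distrC [in X in _ <= X]distrC.
have cf : {within `[x, y], continuous f}.
  apply: continuous_subspaceT => z; apply: differentiable_continuous.
  by apply/derivable1_diffP; apply: ex_derive.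
have [z _ e] := MVT_segment lexy (fun x _ => fdf x) cf.
by rewrite distrC e [in X in _ <= X]distrC normrM ler_wpM2r.
Qed.

Lemma normr_tanh_le1 x : `|sinh x / cosh x| <= 1.
Proof.
rewrite normrM normfV (gtr0_norm (cosh_gt0 _)) ler_pdivrMr ?cosh_gt0// mul1r.
exact/ltW/normr_sinh_lt.
Qed.

Lemma lncosh_lip x y : `|ln (cosh x) - ln (cosh y)| <= `|x - y|.
Proof.
rewrite -[leRHS]mul1r.
by apply: (lipschitz_derive (fun x => is_derive_lncosh x)); exact: normr_tanh_le1.
Qed.

Lemma Afun_lncosh J w : Afun J w = 2^-1 * (ln (cosh (w + J)) - ln (cosh (w - J))).
Proof. by rewrite /Afun ln_div // posrE cosh_gt0. Qed.

Lemma Bfun_lncosh J w :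
  Bfun J w = 2^-1 * (ln 4 + (ln (cosh (w + J)) + ln (cosh (w - J)))).
Proof. have [c1 c2] := (cosh_gt0 (w + J), cosh_gt0 (w - J)).
by rewrite /Bfun -mulrA lnM 1?lnM ?posrE// mulr_gt0. Qed.

(** B and A are the half sum and the half difference of ln (2 cosh (w + J)) and ln (2 cosh (w - J)),
    so B + A and B - A recover these two logarithms. *)
Lemma expR_BDA J w : expR (Bfun J w + Afun J w) = 2 * cosh (w + J).
Proof.
have -> : Bfun J w + Afun J w = ln 2 + ln (cosh (w + J)).
  rewrite Bfun_lncosh Afun_lncosh.
  have -> : 4 = 2 * 2 :> R by lra.
  by rewrite lnM ?posrE//; lra.
by rewrite expRD !lnK ?posrE ?cosh_gt0.
Qed.

Lemma expR_BBA J w : expR (Bfun J w - Afun J w) = 2 * cosh (w - J).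
Proof.
have -> : Bfun J w - Afun J w = ln 2 + ln (cosh (w - J)).
  rewrite Bfun_lncosh Afun_lncosh.
  have -> : 4 = 2 * 2 :> R by lra.
  by rewrite lnM ?posrE//; lra.
by rewrite expRD !lnK ?posrE ?cosh_gt0.
Qed.

(** This is where the factor cosh J of [lambda] comes from in the normalisation of g. *)
Lemma cosh_Afun_expR_Bfun J w :
  cosh (Afun J w) * expR (Bfun J w) = 2 * cosh w * cosh J.
Proof.
have := expR_BDA J w; have := expR_BBA J w; have := cosh_add_sub w J.
rewrite !expRD [cosh (Afun J w)]/cosh => *; lra.
Qed.

Lemma expR_Bfun0 J : expR (Bfun J 0) = 2 * cosh J.
Proof.
have := cosh_Afun_expR_Bfun J 0.
by rewrite /Afun add0r sub0r coshN divff ?gt_eqF ?cosh_gt0// ln1 mulr0 cosh0 mul1r mulr1.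
Qed.

(** The derivative of B is the mean of tanh (z + J) and tanh (z - J). *)
Lemma Bfun_lip J x y : `|Bfun J x - Bfun J y| <= `|x - y|.
Proof.
rewrite -[in leRHS](mul1r `|_|).
have dL := is_derive_lncoshD.
apply: (@lipschitz_derive _
   (fun z => 2^-1 * (sinh (z + J) / cosh (z + J) + sinh (z - J) / cosh (z - J)))).
  move=> z.
  have := is_deriveD (is_derive_cst (2^-1 * ln 4) z 1)
    (is_deriveZ 2^-1 (is_deriveD (dL J z) (dL (- J) z))).
  rewrite add0r; congr is_derive; apply/funext => t.
  by rewrite Bfun_lncosh mulrDr.
move=> z; rewrite normrM ger0_norm ?invr_ge0//.
apply: le_trans (ler_wpM2l _ (ler_normD _ _)) _; first by rewrite invr_ge0.
have := normr_tanh_le1 (z + J); have := normr_tanh_le1 (z - J); lra.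
Qed.

(** This is |tanh J|. *)
Definition contraction J : R := `|sinh J| / cosh J.

Lemma contraction_ge0 J : 0 <= contraction J.
Proof. by rewrite divr_ge0// ltW// cosh_gt0. Qed.

Lemma contraction_lt1 J : contraction J < 1.
Proof. by rewrite ltr_pdivrMr ?cosh_gt0// mul1r normr_sinh_lt. Qed.

(** The derivative of A at z is sinh J cosh J / (sinh^2 z + cosh^2 J), whose modulus is largest at z
    = 0, where it equals |tanh J|. *)
Lemma Afun_lip J x y : `|Afun J x - Afun J y| <= contraction J * `|x - y|.
Proof.
have dL := is_derive_lncoshD.
apply: (@lipschitz_derive _
   (fun z => 2^-1 * (sinh (z + J) / cosh (z + J) - sinh (z - J) / cosh (z - J)))).
  move=> z.
  have := is_deriveZ 2^-1 (is_deriveB (dL J z) (dL (- J) z)).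
  by congr is_derive; apply/funext => t; rewrite Afun_lncosh.
move=> z.
have c1 := cosh_gt0 (z + J); have c2 := cosh_gt0 (z - J); have c3 := cosh_gt0 J.
have -> : 2^-1 * (sinh (z + J) / cosh (z + J) - sinh (z - J) / cosh (z - J)) =
  2^-1 * (sinh (z + J) * cosh (z - J) - sinh (z - J) * cosh (z + J)) /
    (cosh (z + J) * cosh (z - J)).
  by field; rewrite !gt_eqF.
rewrite sinh_mul_sub cosh_addM_sub.
have -> : 2^-1 * (2 * sinh J * cosh J) = sinh J * cosh J by field.
rewrite /contraction (normrM (_ * _)) (normrM (sinh J)) (gtr0_norm c3) -mulrA ler_wpM2l//.
have D : 0 < sinh z ^+ 2 + cosh J ^+ 2 by rewrite ltr_wpDl ?sqr_ge0// exprn_gt0.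
rewrite normfV (gtr0_norm D) ler_pdivrMr// mulrC ler_pdivlMr//.
by rewrite -expr2 lerDr sqr_ge0.
Qed.

(** A is half the difference of ln cosh, a 1-Lipschitz function, at two points 2 |J| apart. *)
Lemma Afun_bound J x : `|Afun J x| <= `|J|.
Proof.
rewrite Afun_lncosh normrM ger0_norm ?invr_ge0//.
have := lncosh_lip (x + J) (x - J).
have -> : x + J - (x - J) = J * 2 by lra.
rewrite normrM [`|2|]ger0_norm//; lra.
Qed.

End hyperbolic.

Arguments contraction {R} J.

Lemma spinE (R : realType) (b : bool) : spin b = (if b then -1 else 1) :> R.
Proof. by case: b; rewrite /spin ?expr0 ?expr1. Qed.

Lemma normr_spin (R : realType) (b : bool) : `|spin b| = 1 :> R.
Proof. by rewrite spinE; case: b; rewrite ?normrN1 ?normr1. Qed.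

Lemma geometric_small (R : realType) (z c e : R) : 0 <= z < 1 -> 0 < e ->
  exists n, forall m, (n <= m)%N -> c * z ^+ m < e.
Proof.
move=> /andP[z0 z1] e0.
have : (fun n => c * z ^+ n) @ \oo --> c * 0.
  by apply: cvgM; [exact: cvg_cst|apply: cvg_expr; rewrite ger0_norm].
rewrite mulr0 => /cvgrPdist_lt /(_ e e0) [n _ h].
exists n => m nm; have := h m nm.
by rewrite /= sub0r normrN; apply: le_lt_trans; exact: ler_norm.
Qed.

(** * Convergence, locality and recursion of the field *)

Section field.
Variables (R : realType) (J K : R).
Implicit Types (y v : Omega) (m i : nat).

Local Notation F := (field_iter J K).

Definition field_radius : R := `|K| + `|J|.

Lemma field_radius_ge0 : 0 <= field_radius.
Proof. by rewrite addr_ge0. Qed.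

Lemma field_iter_bound y m i : `|F y m i| <= field_radius.
Proof.
case: m => [|m] /=; first by rewrite normr0 field_radius_ge0.
apply: le_trans (ler_normD _ _) _.
by rewrite normrM normr_spin mulr1 lerD2l Afun_bound.
Qed.

Lemma field_iter_ext y v m i j :
  (forall a, (a < m)%N -> y (i + a)%N = v (j + a)%N) -> F y m i = F v m j.
Proof.
elim: m i j => [//|m IH] i j yv /=.
rewrite (IH _ j.+1); last first.
  by move=> a am; rewrite !addSnnS yv.
by have := yv 0%N; rewrite !addn0 => ->.
Qed.

Lemma field_iter_shift y m i : F (shift y) m i = F y m i.+1.
Proof. by apply: field_iter_ext => a _; rewrite addSn. Qed.

(** Induction on the common depth l: equal letters cancel in the recursion, each application of A
    gains a factor |tanh J|, and the a priori bound on both fields starts the induction. *)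
Lemma field_iter_close y v m m' i l : (l <= m)%N -> (l <= m')%N ->
  (forall j, (j < l)%N -> y (i + j)%N = v (i + j)%N) ->
  `|F y m i - F v m' i| <= 2 * field_radius * contraction J ^+ l.
Proof.
elim: l m m' i => [|l IH] m m' i.
  move=> _ _ _; rewrite expr0 mulr1; apply: le_trans (ler_normB _ _) _.
  by have := field_iter_bound y m i; have := field_iter_bound v m' i; lra.
case: m m' => [//|m] [//|m'] lm lm' yv.
have e0 : y i = v i by have := yv 0%N; rewrite addn0; exact.
rewrite /= e0 opprD addrACA subrr add0r.
apply: le_trans (Afun_lip _ _ _) _.
rewrite exprS mulrCA ler_wpM2l ?contraction_ge0//.
apply: IH => // j jl; rewrite addSnnS; exact: yv.
Qed.

Lemma field_iter_cauchy y i m m' : (m <= m')%N ->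
  `|F y m i - F y m' i| <= 2 * field_radius * contraction J ^+ m.
Proof. by move=> mm'; apply: field_iter_close. Qed.

Lemma field_rate_small e : 0 < e ->
  exists n, forall m, (n <= m)%N ->
    2 * field_radius * contraction J ^+ m < e.
Proof. by apply: geometric_small; rewrite contraction_ge0 contraction_lt1. Qed.

Lemma is_cvg_field_n y i : cvgn (fun n => field_n J K y n i).
Proof.
apply/cauchy_cvgP/cauchy_exP => e e0.
have [n hn] := field_rate_small e0.
exists (F y n i); exists (n + i)%N => // m /= nim.
rewrite /ball /=; apply: le_lt_trans (hn n (leqnn n)).
by apply: field_iter_cauchy; rewrite leq_subRL; lia.
Qed.

Lemma field_iter_field y m i :
  `|F y m i - field J K y i| <= 2 * field_radius * contraction J ^+ m.
Proof.
rewrite /field.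
set c := _ * _ ^+ m.
rewrite ler_distlC; apply/andP; split.
  apply: limr_ge; first exact: is_cvg_field_n.
  exists (m + i)%N => // n /= mn.
  have : `|F y m i - field_n J K y n i| <= c by apply: field_iter_cauchy; lia.
  by rewrite ler_norml; lra.
apply: limr_le; first exact: is_cvg_field_n.
exists (m + i)%N => // n /= mn.
have : `|F y m i - field_n J K y n i| <= c by apply: field_iter_cauchy; lia.
by rewrite ler_norml; lra.
Qed.

Lemma field_bound y i : `|field J K y i| <= field_radius.
Proof.
rewrite ler_norml; apply/andP; split.
  apply: limr_ge; first exact: is_cvg_field_n.
  by near=> n; have := field_iter_bound y (n.+1 - i) i; rewrite ler_norml => /andP[].
apply: limr_le; first exact: is_cvg_field_n.
by near=> n; have := field_iter_bound y (n.+1 - i) i; rewrite ler_norml => /andP[].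
Unshelve. all: by end_near. Qed.

(** Both fields are compared with the iterate of depth l that they share, so the constant
    doubles. *)
Lemma field_close y v i l : (forall j, (j < i + l)%N -> y j = v j) ->
  `|field J K y i - field J K v i| <= 4 * field_radius * contraction J ^+ l.
Proof.
move=> yv.
have e : F y l i = F v l i.
  by apply: field_iter_ext => a al; rewrite yv// ltn_add2l.
have := field_iter_field y l i; have := field_iter_field v l i.
by rewrite e !ler_norml; lra.
Qed.

Lemma field_shift y i : field J K (shift y) i = field J K y i.+1.
Proof.
apply/eqP; rewrite -subr_eq0 -normr_le0; apply/ler_addgt0Pr => e e0; rewrite add0r.
have [n hn] := field_rate_small (divr_gt0 e0 (ltr0n R 2)).
have := hn n (leqnn n).
have := field_iter_field (shift y) n i; have := field_iter_field y n i.+1.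
by rewrite field_iter_shift !ler_norml; lra.
Qed.

(** The finite recursion passes to the limit because A is Lipschitz; depths n + 1 at i and n at i +
    1 correspond. *)
Lemma field_rec y i : field J K y i = K * spin (y i) + Afun J (field J K y i.+1).
Proof.
apply/eqP; rewrite -subr_eq0 -normr_le0; apply/ler_addgt0Pr => e e0; rewrite add0r.
have [n hn] := field_rate_small (divr_gt0 e0 (ltr0n R 2)).
have h1 := hn n (leqnn n); have h2 := hn _ (leqnSn n).
have h3 := field_iter_field y n.+1 i; have h4 := field_iter_field y n i.+1.
have : `|Afun J (F y n i.+1) - Afun J (field J K y i.+1)| <=
    2 * field_radius * contraction J ^+ n.
  apply: le_trans (Afun_lip _ _ _) _; apply: le_trans h4.
  by rewrite ler_piMl// ltW// contraction_lt1.
by move: h3; rewrite /= !ler_norml; lra.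
Qed.

End field.

(** * Cylinders as a base of the topology and as generators of the Borel sets *)

Lemma nbhs_coordinate (y : Omega) i : nbhs y [set v : Omega | v i = y i].
Proof.
have h : (fun v : Omega => (v : nat -> bool) i) @ nbhs y --> y i.
  by have /pointwise_cvgP := @cvg_id _ (nbhs y); exact.
exact: (h [set y i] (discrete_set1 _)).
Qed.

Lemma nbhs_cylinder (y : Omega) n : nbhs y (cylinder n y).
Proof.
elim: n => [|n IH]; first by apply: filterS filterT => v _ i.
apply: filterS (filterI IH (nbhs_coordinate y n)) => v [h1 /= h2] i.
by rewrite ltnS leq_eqVlt => /orP[/eqP->//|/h1].
Qed.

(** If no cylinder around y lay inside U, then points v_n of [cylinder n y] outside U would converge
    to y coordinate by coordinate, and so would enter U. *)
Lemma nbhs_cylinderP (y : Omega) (U : set Omega) :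
  nbhs y U <-> exists n, cylinder n y `<=` U.
Proof.
split=> [yU|[n nU]]; last exact: filterS nU (nbhs_cylinder y n).
apply: contrapT => /forallNP h.
have {}h n : exists v : Omega, cylinder n y v /\ ~ U v.
  by have /existsNP[v /not_implyP] := h n; exists v.
have [v hv] := choice h.
have cv : v @ \oo --> y.
  apply/pointwise_cvgP => i A /nbhs_singleton Ay.
  exists i.+1 => // n /= ni.
  by rewrite (hv n).1.
have [n _ /(_ n (leqnn n))] := cv U yU.
exact: (hv n).2.
Qed.

Lemma open_cylinder n (y : Omega) : open (cylinder n y).
Proof.
rewrite openE => v yv; apply: filterS (nbhs_cylinder v n) => u vu i ni.
by rewrite vu// yv.
Qed.

Lemma continuous_field (R : realType) (J K : R) i :
  continuous (fun y : Omega => field J K y i).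
Proof.
move=> y; apply/cvgrPdist_lt => e e0.
have [n hn] := field_rate_small J K (divr_gt0 e0 (ltr0n R 2)).
apply: filterS (nbhs_cylinder y (i + n)) => v yv.
have := hn n (leqnn n).
have : `|field J K y i - field J K v i| <= 4 * field_radius J K * contraction J ^+ n.
  by apply: field_close => j ji; rewrite yv.
by rewrite -/(contraction J); lra.
Qed.

Definition word_cylinder (s : seq bool) : set Omega :=
  cylinder (size s) (nth false s).

Lemma cylinderW n (y v : Omega) : cylinder n y v -> cylinder n v = cylinder n y.
Proof.
by move=> yv; apply/seteqP; split=> u h i ni; rewrite h ?yv.
Qed.

Lemma cylinder_word n (y : Omega) : cylinder n y = word_cylinder (mkseq y n).
Proof.
apply/seteqP; split=> v h i; first by rewrite size_mkseq => ni; rewrite nth_mkseq ?h.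
by move=> ni; rewrite h ?size_mkseq// nth_mkseq.
Qed.

(** The union is indexed by finite words, hence countable: open sets therefore belong to the
    sigma-algebra of the cylinders. *)
Lemma open_bigcup_cylinder (U : set Omega) : open U ->
  U = \bigcup_(s : seq bool)
    (if `[< word_cylinder s `<=` U >] then word_cylinder s else set0).
Proof.
move=> oU; apply/seteqP; split=> [y Uy|y [s _]].
  have /nbhs_cylinderP[n nU] := open_nbhs_nbhs (conj oU Uy).
  exists (mkseq y n) => //; rewrite -cylinder_word.
  by case: asboolP => // _ i.
by case: asboolP => // h /h.
Qed.

Lemma measurable_open (U : set Omega) : open U -> measurable U.
Proof. by move=> oU; exact: sub_sigma_algebra. Qed.

Lemma measurable_cylinder n (y : Omega) : measurable (cylinder n y).
Proof. by apply: measurable_open; exact: open_cylinder. Qed.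

(** Two cylinders are nested or disjoint; adding the empty set makes the class closed under
    intersection, as uniqueness of measures requires. *)
Definition cylinders : set (set Omega) :=
  [set A | A = set0 \/ exists n y, A = cylinder n y].

Lemma setI_closed_cylinders : setI_closed cylinders.
Proof.
move=> A B [->|[n [y ->]]]; first by rewrite set0I; left.
move=> [->|[m [v ->]]]; first by rewrite setI0; left.
have [->|/set0P[u [yu vu]]] := eqVneq (cylinder n y `&` cylinder m v) set0.
  by left.
right; rewrite -(cylinderW yu) -(cylinderW vu).
exists (maxn n m), u; apply/seteqP; split=> w.
  move=> [h1 h2] i; rewrite leq_max => /orP[/h1//|/h2//].
by move=> h; split=> i hi; apply: h; rewrite leq_max hi ?orbT.
Qed.

Lemma sigma_cylindersE : @measurable _ Omega = <<s cylinders >>.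
Proof.
apply/seteqP; split; last first.
  apply: smallest_sub; first exact: sigma_algebra_measurable.
  move=> A [->|[n [y ->]]]; [exact: measurable0|exact: measurable_cylinder].
apply: smallest_sub; first exact: smallest_sigma_algebra.
move=> U oU; rewrite (open_bigcup_cylinder oU).
apply: (@countable_bigcupT_measurable _ (g_sigma_algebraType cylinders)).
  exact: countableP.
move=> s; case: ifPn => _; last exact: (@measurable0 _ (g_sigma_algebraType cylinders)).
by apply: sub_sigma_algebra; right; exists (size s), (nth false s).
Qed.

Lemma cylinder_measure_unique (R : realType) (m1 m2 : {measure set Omega -> \bar R}) :
  (m1 setT < +oo)%E -> (forall n y, m1 (cylinder n y) = m2 (cylinder n y)) ->
  forall A, measurable A -> m1 A = m2 A.
Proof.
move=> fin e; apply: (@measure_unique _ _ _ cylinders (fun=> setT)).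
- exact: sigma_cylindersE.
- exact: setI_closed_cylinders.
- by move=> _; right; exists 0%N, point; apply/seteqP; split=> // v _ i.
- by rewrite bigcup_const.
- by move=> A [->|[n [y ->]]//]; rewrite !measure0.
- by [].
Qed.

Definition set_coordinate (y : Omega) (n : nat) (a : bool) : Omega :=
  fun i => if i == n then a else y i.

Lemma cylinder_coordinate (y : Omega) n a :
  cylinder n.+1 (set_coordinate y n a) = cylinder n y `&` [set v | v n = a].
Proof.
apply/seteqP; split=> v.
  move=> h; split=> [i ni|/=].
    by rewrite h ?ltnS ?(ltnW ni)// /set_coordinate ltn_eqF.
  by rewrite h// /set_coordinate eqxx.
move=> [h e] i; rewrite ltnS leq_eqVlt /set_coordinate => /orP[/eqP->|ni].
  by rewrite eqxx.
by rewrite ltn_eqF// h.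
Qed.

Lemma measurable_coordinate n a : measurable [set v : Omega | v n = a].
Proof.
apply: measurable_open; rewrite openE => v va.
by apply: filterS (nbhs_coordinate v n) => u /= ->.
Qed.

Lemma measure_cylinder_split (R : realType) (m : {measure set Omega -> \bar R})
    (y : Omega) n :
  m (cylinder n y) = (\sum_(a : bool) m (cylinder n.+1 (set_coordinate y n a)))%E.
Proof.
rewrite big_bool /= -measureU//; try exact: measurable_cylinder.
  rewrite !cylinder_coordinate -setIUr; congr (m _).
  by apply/seteqP; split=> [v h|v []//]; split=> //=; case: (v n); [left|right].
rewrite !cylinder_coordinate; apply/seteqP; split=> // v [[_ /= ->] [_ /=]].
by [].
Qed.

Lemma measurable_determined n (A : set Omega) :
  (forall v u, cylinder n v u -> A v -> A u) -> measurable A.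
Proof.
move=> h; apply: measurable_open; rewrite openE => v Av.
by apply: filterS (nbhs_cylinder v n) => u vu; exact: h vu Av.
Qed.

Lemma continuous_measurable_Omega (R : realType) (f : Omega -> R) :
  continuous f -> measurable_fun setT f.
Proof.
move=> cf; apply: (measurability _ (@RGenOpens.measurableE R)).
move=> _ [_ [a [b ->] <-]]; rewrite setTI; apply: measurable_open.
by move/continuousP : cf; apply; exact: interval_open.
Qed.

Lemma measurable_shift : measurable_fun setT (shift : Omega -> Omega).
Proof.
apply: (measurability _ sigma_cylindersE) => _ [_ [->|[n [y ->]]] <-].
  by rewrite preimage_set0 setI0.
rewrite setTI; apply: (@measurable_determined n.+1) => v u vu h i ni.
by rewrite -h// /Defs.shift vu// ltnS.
Qed.

Lemma measurable_iter_shift k : measurable_fun setT (iter k shift : Omega -> Omega).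
Proof.
elim: k => [|k IH]; first exact: measurable_id.
exact: measurableT_comp measurable_shift IH.
Qed.

Lemma iter_shiftE k (w : Omega) i : iter k shift w i = w (k + i)%N.
Proof. by elim: k i => [//|k IH] i; rewrite iterS /Defs.shift IH addSnnS. Qed.

Lemma continuous_shift : continuous (shift : Omega -> Omega).
Proof.
move=> y A /nbhs_cylinderP[n nA]; apply/nbhs_cylinderP; exists n.+1 => v yv.
by apply: nA => i ni; apply: yv.
Qed.

Lemma scons_shift (w : Omega) : scons (w 0%N) (shift w) = w.
Proof. by apply/funext => -[]. Qed.

Lemma shift_scons a (w : Omega) : shift (scons a w) = w.
Proof. exact/funext. Qed.

(** * The Ising form of the probabilities and the weight of a cylinder *)

Lemma spin_addb (R : realType) (a b : bool) : spin (a (+) b) = spin a * spin b :> R.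
Proof. by rewrite /spin signr_addb. Qed.

Lemma spin_inj (R : realType) : injective (spin : bool -> R).
Proof.
by move=> a b; rewrite !spinE; case: a; case: b => // h; exfalso; move: h; lra.
Qed.

(** Read with q = p, b = x xor x' this is a transition probability; with q = eps, b = x xor y it is
    a noise probability. *)
Lemma expR_half_logit (R : realType) (q : R) (b : bool) : 0 < q < 1 ->
  let H := 2^-1 * ln ((1 - q) / q) in
  expR (H * spin b) / (2 * cosh H) = if b then q else 1 - q.
Proof.
move=> /andP[q0 q1] H.
have q1' : 0 < 1 - q by lra.
have a0 : 0 < (1 - q) / q by rewrite divr_gt0.
have e : expR H ^+ 2 = (1 - q) / q.
  by rewrite -expRM_natr (_ : _ * _ = ln ((1 - q) / q)) ?lnK// /H; lra.
have h : expR H ^+ 2 * q = 1 - q by rewrite e divfK// gt_eqF.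
have H0 := expR_gt0 H.
have n0 : expR H + (expR H)^-1 != 0 by rewrite gt_eqF// addr_gt0// invr_gt0.
have -> : 2 * cosh H = expR H + (expR H)^-1.
  by rewrite /cosh expRN; field; rewrite gt_eqF.
rewrite spinE; case: b; rewrite ?mulr1 ?mulrN1 ?expRN; apply: (mulIf n0);
  rewrite divfK//; apply: (mulIf (lt0r_neq0 H0));
  rewrite mulrDr mulrDl -!mulrA mulVf ?gt_eqF// mulr1 -expr2; lra.
Qed.

Lemma Bfun_half_logit (R : realType) (q u : R) : 0 < q < 1 ->
  Bfun (2^-1 * ln ((1 - q) / q)) u = 2^-1 * ln (4 * sinh u ^+ 2 + (q * (1 - q))^-1).
Proof.
move=> q01; rewrite /Bfun -mulrA cosh_addM_sub mulrDr.
set H := 2^-1 * ln (_ / _).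
suff -> : 4 * cosh H ^+ 2 = (q * (1 - q))^-1 by [].
(* The two probabilities exp (-H) / (2 cosh H) and exp H / (2 cosh H) multiply to 1 / (4 cosh^2
   H). *)
have := expR_half_logit true q01; have := expR_half_logit false q01.
rewrite -/H !spinE /= mulr1 mulrN1 => <- e; rewrite -{}[in RHS]e.
have n0 : cosh H != 0 by rewrite gt_eqF// cosh_gt0.
have n1 : expR H != 0 by rewrite gt_eqF// expR_gt0.
by rewrite expRN; field; rewrite n0 n1.
Qed.

Section weights.
Variables (R : realType) (J K : R).
Local Notation F := (field_iter J K).

(** Factor t is read at site t + 1, from the n - t - 1 letters that remain there. The last one, t =
    n - 1, is exp (B 0) = 2 cosh J: n letters have only n - 1 transitions, but lambda is divided out
    n times. *)
Definition cylinder_weight (n : nat) (y : Omega) : R :=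
  lambda J K ^- n * (cosh (F y n 0) *
    \prod_(t < n) expR (Bfun J (F y (n - t.+1) t.+1))).

Lemma lambda_gt0 : 0 < lambda J K.
Proof. by apply: mulr_gt0; [apply: mulr_gt0|]; rewrite ?cosh_gt0. Qed.

Lemma lambda_expVS n :
  lambda J K ^- n.+1 = lambda J K ^- n / ((2 * cosh J) * (2 * cosh K)).
Proof.
by rewrite exprSr [in LHS]invfM; congr (_ * _^-1); rewrite /lambda; ring.
Qed.

(* The conditional weight of the letters y i, ..., y (i + m - 1) of the hidden
   Markov process given that the hidden chain is in the state x at time i - 1. *)
Fixpoint backward_weight (y : Omega) (m i : nat) (x : bool) : R :=
  if m is m'.+1 then
    \sum_(a : bool) expR (J * spin (x (+) a)) / (2 * cosh J) *
      (expR (K * spin (a (+) y i)) / (2 * cosh K) * backward_weight y m' i.+1 a)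
  else 1.

Lemma sum_spin_expR (h : R) : \sum_(a : bool) expR (h * spin a) = 2 * cosh h.
Proof. by rewrite big_bool /= !spinE mulr1 mulrN1 /cosh; lra. Qed.

Lemma expR_Bfun_Afun_spin (w : R) (x : bool) :
  expR (Bfun J w) * expR (Afun J w * spin x) = 2 * cosh (w + J * spin x).
Proof.
rewrite -expRD spinE; case: x; rewrite !(mulr1, mulrN1); [exact: expR_BBA|exact: expR_BDA].
Qed.

Lemma backward_weightE (y : Omega) m i x :
  backward_weight y m i x = lambda J K ^- m *
    (expR (Afun J (F y m i) * spin x) *
     \prod_(t < m) expR (Bfun J (F y (m - t) (i + t)))).
Proof.
elim: m i x => [|m IH] i x.
  rewrite /= expr0 invr1 mul1r big_ord0 mulr1 /Afun add0r sub0r coshN divff.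
    by rewrite ln1 mulr0 mul0r expR0.
  by rewrite gt_eqF// cosh_gt0.
rewrite big_ord_recl subn0 addn0 [backward_weight _ _ _ _]/=.
set w := F y m.+1 i.
rewrite (eq_bigr (fun a => (lambda J K ^- m.+1 *
     (\prod_(t < m) expR (Bfun J (F y (m - t) (i.+1 + t))))) *
       expR ((w + J * spin x) * spin a))); last first.
  move=> a _; rewrite IH.
  (* Transition, noise and the contribution of the later letters add up to one spin a in the field w
     + J x. *)
  rewrite (_ : (w + _) * spin a = J * spin (x (+) a) + K * spin (a (+) y i) +
                Afun J (F y m i.+1) * spin a); last first.
    by rewrite /w /= !spin_addb; ring.
  rewrite !expRD lambda_expVS; move: (lambda J K ^- m) => L.
  have j0 : cosh J != 0 by rewrite gt_eqF// cosh_gt0.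
  have k0 : cosh K != 0 by rewrite gt_eqF// cosh_gt0.
  by field; rewrite j0 k0.
(* Summing over a splits into exp (B w), the new factor t = 0 of the product, and exp (A w x),
   passed on to the left neighbour. *)
rewrite -big_distrr /= sum_spin_expR -expR_Bfun_Afun_spin.
under [in RHS]eq_bigr => t _ do rewrite /bump add1n subSS -addSnnS.
by ring.
Qed.

Lemma cylinder_weightS n y : cylinder_weight n.+1 y =
  \sum_(a : bool) 2^-1 * (expR (K * spin (a (+) y 0%N)) / (2 * cosh K) *
    backward_weight y n 1 a).
Proof.
rewrite /cylinder_weight.
rewrite [RHS](eq_bigr (fun a => 2^-1 / (2 * cosh K) * lambda J K ^- n *
     (\prod_(t < n) expR (Bfun J (F y (n - t) (1 + t)))) *
       expR (F y n.+1 0 * spin a))); last first.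
  move=> a _; rewrite backward_weightE.
  rewrite (_ : F y n.+1 0 * spin a = K * spin (a (+) y 0%N) + Afun J (F y n 1) * spin a).
    by rewrite expRD; ring.
  by rewrite /= spin_addb; ring.
(* The factor exp (B 0) = 2 cosh J at the absent site n + 1 compensates the transition that does not
   precede the first letter. *)
rewrite -big_distrr /= sum_spin_expR big_ord_recr /= subnn /= expR_Bfun0.
under eq_bigr => t _ do rewrite subSS.
rewrite lambda_expVS; move: (lambda J K ^- n) => L.
have j0 : cosh J != 0 by rewrite gt_eqF// cosh_gt0.
have k0 : cosh K != 0 by rewrite gt_eqF// cosh_gt0.
by field; rewrite j0 k0.
Qed.

End weights.

(** * The law of the observed process on cylinders *)

Section hidden_markov_law.
Variables (R : realType) (p eps : R).
Hypotheses (hp : 0 < p < 1) (heps : 0 < eps < 1).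
Variables (d : measure_display) (T : measurableType d) (P : probability T R).
Variables (X Z : nat -> {RV P >-> bool}) (Y : nat -> T -> bool).
Hypothesis hX : is_symmetric_chain P p X.
Hypothesis hZ : mutually_independent P Z.
Hypothesis hZm1 : forall n, P [set t | spin (Z n t) = -1 :> R] = eps%:E.
Hypothesis hZ1 : forall n, P [set t | spin (Z n t) = 1 :> R] = (1 - eps)%:E.
Hypothesis hXZ : independent_processes P X Z.
Hypothesis hY : forall n t, spin (Y n t) = spin (X n t) * spin (Z n t) :> R.
Let J : R := 2^-1 * ln ((1 - p) / p).
Let K : R := 2^-1 * ln ((1 - eps) / eps).

Let noise (b : bool) : R := if b then eps else 1 - eps.

Lemma noise_prob n b : P (Z n @^-1` [set b]) = (noise b)%:E.
Proof.
have e1 : (-1 : R) = spin true by rewrite spinE.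
have e0 : (1 : R) = spin false by rewrite spinE.
case: b; rewrite /noise.
  rewrite -(hZm1 n); congr (P _); apply/seteqP; split=> t /=; first by move=> ->.
  by rewrite e1 => /spin_inj.
rewrite -(hZ1 n); congr (P _); apply/seteqP; split=> t /=; first by move=> ->.
by rewrite [X in _ = X -> _]e0 => /spin_inj.
Qed.

Lemma noise_cylinder_prob n (z : Omega) :
  P (trajectory Z @^-1` cylinder n z) = (\prod_(i < n) noise (z i))%:E.
Proof.
have := hZ (fun i => [set z i]) (iota_uniq 0 n).
under eq_bigr => i _ do rewrite noise_prob.
rewrite prodEFin => e.
rewrite -(big_mkord xpredT (fun i => noise (z i))) /index_iota subn0 -e.
congr (P _); apply/seteqP; split=> t h i; first by rewrite mem_iota add0n; exact: h.
by move=> ni; apply: h; rewrite mem_iota add0n.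
Qed.

Lemma hidden_cylinder_prob n (x z : Omega) :
  P (trajectory X @^-1` cylinder n.+1 x `&` trajectory Z @^-1` cylinder n.+1 z) =
  (2^-1 * \prod_(i < n) transition p (x i) (x i.+1) *
   \prod_(i < n.+1) noise (z i))%:E.
Proof.
rewrite hXZ; [|exact: measurable_cylinder..].
(* The conditions i <= n and i < n.+1 are convertible, so [hX] speaks of the cylinder of length n +
   1. *)
by rewrite noise_cylinder_prob EFinM -(hX n x).
Qed.

Lemma observation_xor n t : Y n t = X n t (+) Z n t.
Proof. by apply: (@spin_inj R); rewrite hY spin_addb. Qed.

(** Interpolates between the observed cylinder, j = 0, and a completely prescribed hidden path, j =
    n. *)
Let joint (n j : nat) (x y : Omega) : set T :=
  trajectory X @^-1` cylinder j x `&` trajectory Y @^-1` cylinder n y.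

Lemma measurable_joint n j x y : measurable (joint n j x y).
Proof.
have m (W : {RV P >-> bool}) b : measurable [set t | W t = b].
  rewrite -[[set _ | _]]setTI.
  have mW : measurable_fun setT W by exact: measurable_funPT.
  exact: (mW measurableT [set b]).
have mi k (S : nat -> set T) : (forall i, measurable (S i)) ->
    measurable [set t | forall i, (i < k)%N -> S i t].
  move=> mS; rewrite (_ : [set _ | _] = \bigcap_(i in [set i | (i < k)%N]) S i)//.
  exact: bigcap_measurableType.
apply: measurableI; apply: mi => i; first exact: m.
(* Events of Y are measurable because Y is X xor Z, with X and Z measurable. *)
rewrite (_ : (fun t => _) = ([set t | X i t = true] `&` [set t | Z i t = ~~ y i]) `|`
   ([set t | X i t = false] `&` [set t | Z i t = y i])).
  by apply: measurableU; apply: measurableI; exact: m.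
apply/seteqP; split=> t /=; rewrite /trajectory observation_xor.
  by case: (X i t); case: (Z i t) => <-; [left|left|right|right].
by case=> -[-> ->] //=; rewrite negbK.
Qed.

Lemma joint_split n j x y :
  P (joint n j x y) = (\sum_(a : bool) P (joint n j.+1 (set_coordinate x j a) y))%E.
Proof.
rewrite big_bool /= -measureU//; try exact: measurable_joint.
  rewrite /joint !cylinder_coordinate -setIUl !preimage_setI -setIUr; congr (P (_ `&` _)).
  apply/seteqP; split=> [t h|t []//]; split=> //=.
  by case: (trajectory X t j); [left|right].
rewrite /joint !cylinder_coordinate; apply/seteqP; split=> // t [[[_ /= ->] _]].
by move=> [[_ /=]].
Qed.

Lemma joint_full n x y : P (joint n.+1 n.+1 x y) =
  (2^-1 * \prod_(i < n) transition p (x i) (x i.+1) *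
   \prod_(i < n.+1) noise (x i (+) y i))%:E.
Proof.
(* Once the hidden path is x, observing y means that the noise is x xor y. *)
rewrite -(hidden_cylinder_prob n x (fun i => x i (+) y i)); congr (P _).
apply/seteqP; split=> t [hx h]; split=> // i ni; move: (hx i ni) (h i ni);
  rewrite /trajectory observation_xor => ->.
  by move=> <-; rewrite addKb.
by move=> ->; rewrite addKb.
Qed.

(** Here m counts the hidden states that are still free. The induction step prescribes the next one
    and recognises the sum over its values as one unfolding of [backward_weight]. *)
Lemma joint_backward N m j x y : (N = m + j)%N -> P (joint N.+1 j.+1 x y) =
  (2^-1 * \prod_(i < j) transition p (x i) (x i.+1) *
   \prod_(i < j.+1) noise (x i (+) y i) * backward_weight J K y m j.+1 (x j))%:E.
Proof.
elim: m j x => [|m IH] j x Nj.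
  by rewrite Nj add0n joint_full mulr1.
have sc a k : (k <= j)%N -> set_coordinate x j.+1 a k = x k.
  by move=> kj; rewrite /set_coordinate ltn_eqF.
have scj a : set_coordinate x j.+1 a j.+1 = a by rewrite /set_coordinate eqxx.
rewrite joint_split.
under eq_bigr => a _ do rewrite IH ?addnS//.
rewrite sumEFin; congr EFin; rewrite [backward_weight _ _ _ m.+1 _ _]/= big_distrr /=.
apply: eq_bigr => a _.
rewrite big_ord_recr [in LHS]big_ord_recr /= !scj sc// expR_half_logit// expR_half_logit//.
rewrite (_ : \prod_(i < j) _ = \prod_(i < j) transition p (x i) (x i.+1)); last first.
  by apply: eq_bigr => i _; rewrite !sc// ltnW.
rewrite (_ : \prod_(i < j.+1) _ = \prod_(i < j.+1) noise (x i (+) y i)); last first.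
  by apply: eq_bigr => i _; rewrite sc// -ltnS.
rewrite (_ : transition p (x j) a = if x j (+) a then p else 1 - p); last first.
  by rewrite /transition; case: (x j); case: a.
by rewrite /noise; ring.
Qed.

Lemma hidden_markov_cylinder n y :
  P (trajectory Y @^-1` cylinder n y) = (cylinder_weight J K n y)%:E.
Proof.
case: n => [|N].
  rewrite /cylinder_weight expr0 invr1 mul1r big_ord0 mulr1 /= cosh0.
  by rewrite -(@probability_setT _ _ _ P); congr (P _); apply/seteqP; split.
(* With j = 0 the hidden path is unconstrained, so any sequence can stand in for it. *)
have -> : trajectory Y @^-1` cylinder N.+1 y = joint N.+1 0 y y.
  by apply/seteqP; split=> [t h|t []//]; split.
rewrite joint_split cylinder_weightS -sumEFin; apply: eq_bigr => a _.
rewrite (@joint_backward N N) ?addn0// big_ord0 big_ord_recl big_ord0 !mulr1.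
by rewrite /set_coordinate eqxx /= expR_half_logit// mulrA.
Qed.

End hidden_markov_law.

Local Opaque ln expR cosh sinh Afun Bfun spin.

(** * The function g as a limit of ratios of cylinder weights *)

Section gfunction.
Variables (R : realType) (J K : R).
Local Notation F := (field_iter J K).
Local Notation w := (field J K).
Local Notation M := (field_radius J K).
Local Notation k := (contraction J).
Local Notation lam := (lambda J K).

(** The value of g at first letter a when the letters to the right create the field u: the limit
    field gives g, a field of finite depth gives the ratio of two cylinder weights. *)
Definition local_g (u : R) (a : bool) : R :=
  lam^-1 * (cosh (K * spin a + Afun J u) * expR (Bfun J u) / cosh u).

Lemma local_g_gt0 u a : 0 < local_g u a.
Proof.
rewrite mulr_gt0 ?invr_gt0 ?lambda_gt0// divr_gt0 ?cosh_gt0// mulr_gt0 ?expR_gt0//.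
exact: cosh_gt0.
Qed.

Lemma sum_local_g u : \sum_(a : bool) local_g u a = 1.
Proof.
have u0 : cosh u != 0 by rewrite gt_eqF// cosh_gt0.
have j0 : cosh J != 0 by rewrite gt_eqF// cosh_gt0.
have k0 : cosh K != 0 by rewrite gt_eqF// cosh_gt0.
rewrite -big_distrr /= -big_distrl /= -big_distrl /=.
rewrite (_ : \sum_a _ = 2 * cosh K * cosh (Afun J u)); last first.
  rewrite big_bool /= !spinE mulrN1 mulr1 -(coshN (- K + _)) opprD opprK [LHS]addrC.
  by rewrite cosh_add_sub; ring.
rewrite -(mulrA (2 * cosh K)) cosh_Afun_expR_Bfun /lambda.
by field; rewrite u0 j0 k0.
Qed.

Lemma ln_local_g u a : ln (local_g u a) =
  - ln lam + ln (cosh (K * spin a + Afun J u)) + Bfun J u - ln (cosh u).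
Proof.
have [c1 c2] := (cosh_gt0 u, cosh_gt0 (K * spin a + Afun J u)).
rewrite /local_g lnM ?posrE ?invr_gt0 ?lambda_gt0//; last first.
  by rewrite divr_gt0// mulr_gt0// expR_gt0.
rewrite lnV ?posrE ?lambda_gt0// ln_div ?posrE//; last by rewrite mulr_gt0// expR_gt0.
by rewrite lnM ?posrE ?expR_gt0// expRK; ring.
Qed.

(** Three terms depend on the field, each of them 1-Lipschitz. *)
Lemma ln_local_g_lip u v a : `|ln (local_g u a) - ln (local_g v a)| <= 3 * `|u - v|.
Proof.
have tri (l a1 a2 b1 b2 d1 d2 x : R) : `|a1 - a2| <= x -> `|b1 - b2| <= x ->
    `|d1 - d2| <= x -> `|(- l + a1 + b1 - d1) - (- l + a2 + b2 - d2)| <= 3 * x.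
  by rewrite !ler_norml; lra.
rewrite !ln_local_g; apply: tri; [|exact: Bfun_lip|exact: lncosh_lip].
apply: le_trans (lncosh_lip _ _) _; rewrite opprD addrACA subrr add0r.
apply: le_trans (Afun_lip _ _ _) _.
by rewrite ler_piMl// ltW// contraction_lt1.
Qed.

Lemma local_g_compare u v a d : 3 * `|u - v| <= d ->
  local_g u a <= expR d * local_g v a.
Proof.
move=> uvd; rewrite -[local_g u a]lnK ?posrE ?local_g_gt0//.
rewrite -[X in _ * X]lnK ?posrE ?local_g_gt0// -expRD ler_expR.
by have := ln_local_g_lip u v a; rewrite ler_norml => /andP[_]; lra.
Qed.

Lemma continuous_local_g a : continuous (local_g ^~ a).
Proof.
move=> u.
have lip (f : R -> R) c : (forall x y, `|f x - f y| <= c * `|x - y|) -> continuous f.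
  move=> fc x; apply/cvgrPdist_lt => e e0.
  have c1 : 0 < `|c| + 1 by rewrite ltr_wpDl.
  near=> y; apply: le_lt_trans (fc x y) _.
  apply: (@le_lt_trans _ _ ((`|c| + 1) * `|x - y|)).
    by rewrite ler_wpM2r// (le_trans (ler_norm _))// lerDl.
  rewrite mulrC -ltr_pdivlMr//.
  near: y; apply: cvgr_dist_lt => //; by rewrite divr_gt0.
rewrite (_ : local_g ^~ a = expR \o (fun u => ln (local_g u a))).
  apply: continuous_comp; last exact: continuous_expR.
  exact: (lip _ 3 (fun x y => ln_local_g_lip x y a)).
by apply/funext => x /=; rewrite lnK// posrE local_g_gt0.
Unshelve. all: by end_near. Qed.

Lemma cylinder_weight_gt0 n y : 0 < cylinder_weight J K n y.
Proof.
rewrite /cylinder_weight mulr_gt0 ?invr_gt0 ?exprn_gt0 ?lambda_gt0//.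
by rewrite mulr_gt0 ?cosh_gt0// prodr_gt0// => i _; exact: expR_gt0.
Qed.

(** The factors at sites 2, 3, ... are common to both weights, so only the fields at sites 0 and 1
    survive in the quotient. *)
Lemma cylinder_weight_cons n y : cylinder_weight J K n.+1 y =
  local_g (F y n 1) (y 0%N) * cylinder_weight J K n (shift y).
Proof.
rewrite /cylinder_weight /local_g big_ord_recl /= subn1 /=.
rewrite field_iter_shift.
rewrite [in RHS](eq_bigr (fun t : 'I_n => expR (Bfun J (F y (n - t.+1) t.+2)))); last first.
  by move=> t _; rewrite field_iter_shift.
rewrite [in LHS](eq_bigr (fun t : 'I_n => expR (Bfun J (F y (n - t.+1) t.+2)))); last first.
  by move=> t _; rewrite /bump add1n subSS.
rewrite exprSr invfM; move: (lam ^- n) (\prod_(t < n) _) => L Pi.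
have c0 : cosh (F y n 1) != 0 by rewrite gt_eqF// cosh_gt0.
have l0 : lam != 0 by rewrite gt_eqF// lambda_gt0.
by move: (lam) l0 => l l0; field; rewrite c0 l0.
Qed.

Definition gfun (y : Omega) : R :=
  lam^-1 * (cosh (w y 0) * expR (Bfun J (w y 1)) / cosh (w y 1)).

Lemma gfunE y : gfun y = local_g (w y 1) (y 0%N).
Proof. by rewrite /gfun field_rec. Qed.

Lemma gfun_scons a y : gfun (scons a y) = local_g (w y 0) a.
Proof. by rewrite gfunE -field_shift shift_scons. Qed.

Lemma gfun_gt0 y : 0 < gfun y.
Proof. by rewrite gfunE local_g_gt0. Qed.

Lemma sum_gfun y : \sum_(a : bool) gfun (scons a y) = 1.
Proof. by under eq_bigr => a _ do rewrite gfun_scons; exact: sum_local_g. Qed.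

Lemma gfun_lt1 y : gfun y < 1.
Proof.
rewrite -(scons_shift y) -(sum_gfun (shift y)) (bigD1 (y 0%N))//= ltrDl.
rewrite (bigD1 (~~ y 0%N)) /=; last by case: (y 0%N).
by rewrite ltr_wpDr ?gfun_gt0// sumr_ge0// => i _; exact/ltW/gfun_gt0.
Qed.

Lemma continuous_gfun_scons a : continuous (fun y => gfun (scons a y)).
Proof.
rewrite (_ : (fun y => _) = (local_g ^~ a) \o (fun y => w y 0)).
  move=> y; apply: continuous_comp; first exact: continuous_field.
  exact: continuous_local_g.
by apply/funext => y; rewrite gfun_scons.
Qed.

Lemma continuous_gfun : continuous gfun.
Proof.
move=> y.
have h : (fun v => gfun (scons (y 0%N) (shift v))) @ y --> gfun y.
  rewrite -[in X in _ --> X](scons_shift y).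
  apply: (@continuous_comp _ _ _ shift (fun v => gfun (scons (y 0%N) v))).
    exact: continuous_shift.
  exact: continuous_gfun_scons.
(* The first letter is constant near y, so g agrees there with the function whose first letter is
   frozen. *)
apply: cvg_trans h; apply: near_eq_cvg.
by apply: filterS (nbhs_coordinate y 0) => v /= <-; rewrite scons_shift.
Qed.

(** The Lipschitz constant of ln [local_g] times the distance from the field of depth n to its
    limit. *)
Definition gfun_rate (n : nat) : R := 3 * (2 * M * k ^+ n).

Lemma gfun_cylinder_compare n y v a : cylinder n y v ->
  gfun (scons a v) <= expR (gfun_rate n) * local_g (F y n 0) a /\
  local_g (F y n 0) a <= expR (gfun_rate n) * gfun (scons a v).
Proof.
move=> yv.
have e : F y n 0 = F v n 0 by apply: field_iter_ext => i ni; rewrite add0n yv.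
have := field_iter_field J K v n 0; rewrite -e gfun_scons => h.
by split; apply: local_g_compare; rewrite /gfun_rate ler_pM2l// distrC ?[`|w v 0 - _|]distrC.
Qed.

End gfunction.

(** * Cylinder weights compared with Birkhoff sums of the potential *)

Section gibbs_bound.
Variables (R : realType) (J K : R).
Local Notation F := (field_iter J K).
Local Notation w := (field J K).
Local Notation M := (field_radius J K).
Local Notation k := (contraction J).
Local Notation lam := (lambda J K).

Definition potential (y : Omega) : R := Bfun J (w y 0).

Lemma continuous_potential : continuous potential.
Proof.
move=> y; apply: (@continuous_comp _ _ _ (fun y => w y 0) (Bfun J)).
  exact: continuous_field.
apply/cvgrPdist_lt => e e0; near=> z; apply: le_lt_trans (Bfun_lip _ _ _) _.
by near: z; apply: cvgr_dist_lt.
Unshelve. all: by end_near. Qed.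

Lemma potential_iter_shift n y : potential (iter n shift y) = Bfun J (w y n).
Proof.
have h i : w (iter n shift y) i = w y (i + n).
  by elim: n i => [|n IH] i; rewrite ?addn0// iterS field_shift IH addSnnS.
by rewrite /potential h.
Qed.

(** The geometric series of the field errors, plus M for ln cosh of the field at 0 and 2 M for
    exchanging the fields at 0 and n. *)
Definition gibbs_radius : R := 2 * M / (1 - k) + 3 * M.

Lemma gibbs_radius_ge0 : 0 <= gibbs_radius.
Proof.
have := field_radius_ge0 J K; have := contraction_lt1 J => k1 M0.
by rewrite addr_ge0// ?divr_ge0 ?mulr_ge0//; lra.
Qed.

Lemma ln_cylinder_weight n y : ln (cylinder_weight J K n y) =
  - (n%:R * ln lam) + ln (cosh (F y n 0)) + \sum_(t < n) Bfun J (F y (n - t.+1) t.+1).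
Proof.
have pi0 : 0 < \prod_(t < n) expR (Bfun J (F y (n - t.+1) t.+1)).
  by rewrite prodr_gt0// => i _; exact: expR_gt0.
have ln0 : 0 < lam ^+ n by rewrite exprn_gt0// lambda_gt0.
have c0 := cosh_gt0 (F y n 0).
rewrite /cylinder_weight lnM ?posrE ?invr_gt0//; last by rewrite mulr_gt0.
rewrite lnM ?posrE// lnV ?posrE// lnXn ?lambda_gt0// mulr_natl addrA; congr (_ + _).
by rewrite -expR_sum expRK.
Qed.

Lemma gibbs_estimate n y :
  `|ln (cylinder_weight J K n y) -
    (\sum_(t < n) potential (iter t shift y) - n%:R * ln lam)| <= gibbs_radius.
Proof.
have k1 := contraction_lt1 J; have k0 := contraction_ge0 J.
have M0 := field_radius_ge0 J K.
have hc : `|ln (cosh (F y n 0))| <= M.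
  have := lncosh_lip (F y n 0) 0; rewrite cosh0 ln1 !subr0 => /le_trans; apply.
  exact: field_iter_bound.
have hb : `|Bfun J (w y n) - Bfun J (w y 0)| <= 2 * M.
  apply: le_trans (Bfun_lip _ _ _) _; apply: le_trans (ler_normB _ _) _.
  by have := field_bound J K y n; have := field_bound J K y 0; lra.
have hs : `|\sum_(t < n) (Bfun J (F y (n - t.+1) t.+1) - Bfun J (w y t.+1))| <=
    2 * M / (1 - k).
  apply: le_trans (ler_norm_sum _ _ _) _.
  apply: (@le_trans _ _ (\sum_(t < n) 2 * M * k ^+ (n - t.+1))).
    apply: ler_sum => t _; apply: le_trans (Bfun_lip _ _ _) _.
    exact: field_iter_field.
  (* Reversing the sum replaces the depth n - t - 1 by t and leaves a geometric sum. *)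
  rewrite -(big_mkord xpredT (fun t => 2 * M * k ^+ (n - t.+1))) big_nat_rev /=.
  rewrite big_mkord (eq_bigr (fun t : 'I_n => 2 * M * k ^+ t)); last first.
    by move=> t _; rewrite add0n subnSK// subKn// ltnW.
  rewrite -big_distrr /= ler_wpM2l ?mulr_ge0//.
  have e : (1 - k) * (\sum_(i < n) k ^+ i) = 1 - k ^+ n.
    by rewrite -[LHS]opprK -mulNr opprB -subrX1 opprB.
  rewrite -[_^-1]mul1r ler_pdivlMr ?subr_gt0// mulrC e gerBl exprn_ge0//.
rewrite ln_cylinder_weight.
(* The Birkhoff sum uses the fields at 0, ..., n - 1, the weight those at 1, ..., n; the shift by
   one telescopes to two boundary terms. *)
have -> : \sum_(t < n) potential (iter t shift y) =
    \sum_(t < n) Bfun J (w y t.+1) - (Bfun J (w y n) - Bfun J (w y 0)).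
  rewrite (eq_bigr (fun t : 'I_n => Bfun J (w y t))); last first.
    by move=> t _; rewrite potential_iter_shift.
  rewrite -(big_mkord xpredT (fun t => Bfun J (w y t))).
  rewrite -(big_mkord xpredT (fun t => Bfun J (w y t.+1))).
  rewrite -(telescope_sumr (fun t => Bfun J (w y t)) (leq0n n)) -sumrB.
  by apply: eq_bigr => t _; ring.
move: hs; rewrite sumrB /gibbs_radius; move: hc hb.
by rewrite !ler_norml; lra.
Qed.

End gibbs_bound.

Arguments potential {R} J K y.
Arguments gfun {R} J K y.
Arguments gibbs_radius {R} J K.

(** * Invariance, and the conditional probability of the first letter *)

Lemma cylinder_measure_unique_fun (R : realType) (m1 m2 : set Omega -> \bar R) :
  m1 set0 = 0%E -> (forall A, 0 <= m1 A)%E -> semi_sigma_additive m1 ->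
  m2 set0 = 0%E -> (forall A, 0 <= m2 A)%E -> semi_sigma_additive m2 ->
  (m1 setT < +oo)%E -> (forall n y, m1 (cylinder n y) = m2 (cylinder n y)) ->
  forall A, measurable A -> m1 A = m2 A.
Proof.
move=> m10 m1p m1s m20 m2p m2s fin e A mA.
pose mx1 := isMeasure.Build _ _ _ m1 m10 m1p m1s.
pose mx2 := isMeasure.Build _ _ _ m2 m20 m2p m2s.
pose M1 : {measure set Omega -> \bar R} := HB.pack m1 mx1.
pose M2 : {measure set Omega -> \bar R} := HB.pack m2 mx2.
exact: (@cylinder_measure_unique _ M1 M2).
Qed.

(** The image under f of P restricted to D. It is used with D the whole space for invariance, and
    with D fixing the first letter for the conditional probability. *)
Lemma semi_sigma_additive_preimageI (R : realType) (P : {measure set Omega -> \bar R})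
    (f : Omega -> Omega) (D : set Omega) :
  measurable_fun setT f -> measurable D ->
  semi_sigma_additive (fun A => P (D `&` f @^-1` A)).
Proof.
move=> mf mD A mA tA mUA.
have mfA B : measurable B -> measurable (D `&` f @^-1` B).
  by move=> mB; apply: measurableI => //; rewrite -[X in measurable X]setTI; exact: mf.
rewrite preimage_bigcup setI_bigcupr.
apply: measure_semi_sigma_additive => //.
- by move=> n; exact: mfA.
- apply/trivIsetP => i j _ _ ij; rewrite setIACA setIid -preimage_setI.
  by move/trivIsetP : tA => /(_ _ _ I I ij) ->; rewrite preimage_set0 setI0.
- by rewrite -setI_bigcupr -preimage_bigcup; exact: mfA.
Qed.

Lemma shift_invariant_cylinders (R : realType) (P : probability Omega R) :
  (forall n y, P (shift @^-1` cylinder n y) = P (cylinder n y)) ->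
  shift_invariant P.
Proof.
move=> h; apply: cylinder_measure_unique_fun => //.
- by rewrite preimage_set0 measure0.
- rewrite (_ : (fun _ => _) = (fun B => P (setT `&` shift @^-1` B))).
    exact: semi_sigma_additive_preimageI measurable_shift measurableT.
  by apply/funext => B; rewrite setTI.
- exact: measure_semi_sigma_additive.
- by rewrite preimage_setT probability_setT ltry.
Qed.

Lemma preimage_shift_cylinder n (y : Omega) a :
  [set v : Omega | v 0%N = a] `&` shift @^-1` cylinder n y = cylinder n.+1 (scons a y).
Proof.
apply/seteqP; split=> v; first by move=> [h0 h] [|i] ni //=; exact: h.
by move=> h; split=> [|i ni]; [exact: (h 0%N)|exact: (h i.+1)].
Qed.

Section hidden_markov_measure.
Variables (R : realType) (J K : R) (Q : probability Omega R).
Hypothesis hQ : forall n y, Q (cylinder n y) = (cylinder_weight J K n y)%:E.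

Lemma cylinder_fine n y : fine (Q (cylinder n y)) = cylinder_weight J K n y.
Proof. by rewrite hQ. Qed.

Lemma hidden_markov_fully_supported : fully_supported Q.
Proof.
move=> U oU [y Uy].
have /nbhs_cylinderP[n nU] := open_nbhs_nbhs (conj oU Uy).
apply: (@lt_le_trans _ _ (Q (cylinder n y))).
  by rewrite hQ lte_fin cylinder_weight_gt0.
apply: le_measure; rewrite ?inE//; [exact: measurable_cylinder|exact: measurable_open].
Qed.

Lemma first_letter_cylinder n y a :
  Q ([set v : Omega | v 0%N = a] `&` shift @^-1` cylinder n y) =
  (local_g J K (field_iter J K y n 0) a * cylinder_weight J K n y)%:E.
Proof.
rewrite preimage_shift_cylinder hQ cylinder_weight_cons shift_scons.
by rewrite -field_iter_shift shift_scons.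
Qed.

(** On cylinders, invariance is the normalisation of [local_g] over the letter that the shift
    deletes. *)
Lemma hidden_markov_shift_invariant : shift_invariant Q.
Proof.
apply: shift_invariant_cylinders => n y.
have -> : shift @^-1` cylinder n y =
    \big[setU/set0]_(a : bool) ([set v : Omega | v 0%N = a] `&` shift @^-1` cylinder n y).
  rewrite big_bool /= -setIUl; apply/seteqP; split=> [v h|v []//]; split=> //=.
  by case: (v 0%N); [left|right].
have mcyl a : measurable ([set v : Omega | v 0%N = a] `&` shift @^-1` cylinder n y).
  by rewrite preimage_shift_cylinder; exact: measurable_cylinder.
rewrite big_bool /= measureU//; last first.
  by apply/seteqP; split=> // v [[/= -> _] [/=]].
apply: etrans.
  by apply: congr2; exact: first_letter_cylinder.
rewrite -EFinD -mulrDl.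
have := sum_local_g J K (field_iter J K y n 0); rewrite big_bool /= => ->.
by rewrite mul1r hQ.
Qed.

Lemma gfun_scons_integrable a D : measurable D ->
  Q.-integrable D (EFin \o (fun v => gfun J K (scons a v))).
Proof.
move=> mD; apply: measurable_bounded_integrable => //.
- by rewrite (le_lt_trans (probability_le1 _ mD))// ltry.
- apply: measurable_funTS; apply: continuous_measurable_Omega.
  exact: continuous_gfun_scons.
- exists 1; split=> // x x1 v _ /=; rewrite ger0_norm ?ltW ?gfun_gt0//.
  exact: lt_trans (gfun_lt1 _ _ _) x1.
Qed.

(** On an n-cylinder the integrand differs from the finite-depth ratio by a factor at most E either
    way, and that ratio is constant there. *)
Lemma integral_gfun_cylinder_compare a n y (m := fine (Q (cylinder n y)))
    (I := fine (\int[Q]_(v in cylinder n y) (gfun J K (scons a v))%:E))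
    (E := expR (gfun_rate J K n)) :
  I <= E * (local_g J K (field_iter J K y n 0) a * m) /\
  local_g J K (field_iter J K y n 0) a * m <= E * I.
Proof.
have mc := measurable_cylinder n y.
have cint (c : R) : Q.-integrable (cylinder n y) (EFin \o cst c).
  apply: measurable_bounded_integrable => //.
    by rewrite (le_lt_trans (probability_le1 _ mc))// ltry.
  exact: bounded_cst.
have gint := gfun_scons_integrable a mc.
have cE c : \int[Q]_(v in cylinder n y) cst c v = c * m by rewrite Rintegral_cst.
split.
  rewrite mulrA -cE; apply: le_Rintegral => // v yv.
  by have [] := gfun_cylinder_compare J K a yv.
rewrite -cE /I.
have -> : E * fine (\int[Q]_(v in cylinder n y) (gfun J K (scons a v))%:E) =
   \int[Q]_(v in cylinder n y) (E * gfun J K (scons a v)).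
  by rewrite RintegralZl.
apply: le_Rintegral => //.
  by have := integrableZl mc E gint; apply: eq_integrable.
by move=> v yv; have [] := gfun_cylinder_compare J K a yv.
Qed.

End hidden_markov_measure.

Lemma measure_le_on_cylinders (R : realType) (m1 m2 : {measure set Omega -> \bar R})
    (c : R) N : 0 <= c ->
  (forall y, (m1 (cylinder N y) <= c%:E * m2 (cylinder N y))%E) ->
  forall n y, (n <= N)%N -> (m1 (cylinder n y) <= c%:E * m2 (cylinder n y))%E.
Proof.
move=> c0 h n y nN; rewrite -(subKn nN).
elim: (N - n)%N y => [|j IH] y; first by rewrite subn0.
(* For j >= N both truncated differences are 0. *)
have [jN|Nj] := ltnP j N; last by have -> : (N - j.+1 = N - j)%N by lia.
rewrite !(measure_cylinder_split _ y (N - j.+1)) ge0_sume_distrr//.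
by apply: lee_sum => a _; rewrite subnSK.
Qed.

(** A fixed cylinder is a finite union of N-cylinders for every larger N, so it inherits the bound
    with factor exp (r N); then N tends to infinity. *)
Lemma measure_le_of_rate (R : realType) (m1 m2 : {measure set Omega -> \bar R})
    (r : R^nat) : (m1 setT < +oo)%E -> (m2 setT < +oo)%E -> r @ \oo --> 0 ->
  (forall n y, (m1 (cylinder n y) <= (expR (r n))%:E * m2 (cylinder n y))%E) ->
  forall n y, (m1 (cylinder n y) <= m2 (cylinder n y))%E.
Proof.
move=> fin1 fin2 r0 h n y.
have fin (m : {measure set Omega -> \bar R}) :
    (m setT < +oo)%E -> m (cylinder n y) \is a fin_num.
  move=> fm; rewrite ge0_fin_numE//; apply: le_lt_trans fm.
  by apply: le_measure; rewrite ?inE//; exact: measurable_cylinder.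
have f1 := fin _ fin1; have f2 := fin _ fin2.
rewrite -(fineK f1) -(fineK f2) lee_fin.
set a := fine _; set b := fine _.
have lim : (fun N => expR (r N) * b) @ \oo --> b.
  rewrite -[X in _ --> X]mul1r -(@expR0 R).
  apply: cvgM; last exact: cvg_cst.
  exact: (continuous_cvg _ (@continuous_expR R 0) r0).
apply: (cvgr_to_ge lim); exists n => // N /= nN.
have := measure_le_on_cylinders (expR_ge0 (r N)) (h N) y nN.
by rewrite -(fineK f1) -(fineK f2) -EFinM lee_fin.
Qed.

Lemma gfun_rate_cvg (R : realType) (J K : R) : gfun_rate J K @ \oo --> 0.
Proof.
rewrite /gfun_rate -[X in _ --> X](mulr0 3).
apply: cvgM; first exact: cvg_cst.
rewrite -[X in _ --> X](mulr0 (2 * field_radius J K)).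
apply: cvgM; first exact: cvg_cst.
by apply: cvg_expr; rewrite ger0_norm ?contraction_ge0// contraction_lt1.
Qed.

Lemma integral_shift (R : realType) (P : probability Omega R) (f : Omega -> \bar R)
    (D : set Omega) : shift_invariant P -> measurable D ->
  measurable_fun setT f -> P.-integrable (shift @^-1` D) (f \o shift) ->
  (\int[P]_(x in shift @^-1` D) (f \o shift) x = \int[P]_(x in D) f x)%E.
Proof.
move=> inv mD mf fint.
rewrite -(integral_pushforward measurable_shift)//.
pose m1 (A : set Omega) := P (shift @^-1` A).
have m1s : semi_sigma_additive m1.
  rewrite /m1 (_ : (fun _ => _) = (fun B => P (setT `&` shift @^-1` B))).
    exact: semi_sigma_additive_preimageI measurable_shift measurableT.
  by apply/funext => B; rewrite setTI.
have m10 : m1 set0 = 0%E by rewrite /m1 preimage_set0 measure0.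
have m1p A : (0 <= m1 A)%E by exact: measure_ge0.
pose mx1 := isMeasure.Build _ _ _ m1 m10 m1p m1s.
pose M1 : {measure set Omega -> \bar R} := HB.pack m1 mx1.
change (\int[M1]_(x in D) f x = \int[P]_(x in D) f x)%E.
by apply: eq_measure_integral => A mA _; exact: inv.
Qed.

(** The generating family of [sigma_future], named so that [g_sigma_algebraType] can be applied to
    it. *)
Definition future_coordinates : set (set Omega) :=
  [set A | exists (i : nat) (a : bool), (0 < i)%N /\ A = [set w : Omega | w i = a]].

(** Reduces the test events of the conditional probability to preimages under the shift, on which
    invariance acts. *)
Lemma sigma_futureE : sigma_future = [set shift @^-1` D | D in @measurable _ Omega].
Proof.
have pre : [set shift @^-1` D | D in @measurable _ Omega] =
    preimage_set_system setT (shift : Omega -> Omega) measurable.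
  by apply/seteqP; split=> _ [D mD <-]; exists D => //; rewrite setTI.
apply/seteqP; split.
  apply: smallest_sub.
    by rewrite pre; apply: sigma_algebra_preimage; exact: sigma_algebra_measurable.
  move=> _ [i [a [i0 ->]]]; case: i i0 => // i _; exists [set v : Omega | v i = a] => //.
  exact: measurable_coordinate.
move=> _ [D mD <-]; move: D mD; rewrite sigma_cylindersE.
have sf : sigma_algebra setT sigma_future by exact: smallest_sigma_algebra.
have im := sigma_algebra_image (shift : Omega -> Omega) sf.
suff : <<s cylinders >> `<=` image_set_system setT (shift : Omega -> Omega) sigma_future.
  by move=> h D /h; rewrite /image_set_system /= setTI.
apply: smallest_sub => // A [->|[n [y ->]]]; rewrite /image_set_system /= setTI.
  rewrite preimage_set0; exact: (@measurable0 _ (g_sigma_algebraType future_coordinates)).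
elim: n => [|n IH].
  rewrite (_ : _ @^-1` _ = setT); last by apply/seteqP; split=> // v _ i.
  exact: (@measurableT _ (g_sigma_algebraType future_coordinates)).
rewrite (_ : _ @^-1` _ = shift @^-1` cylinder n y `&` [set v : Omega | v n.+1 = y n]).
  apply: (@measurableI _ (g_sigma_algebraType future_coordinates)) => //.
  by apply: sub_sigma_algebra; exists n.+1, (y n).
apply/seteqP; split=> v; first by move=> h; split=> [i ni|]; [exact/h/ltnW|exact: (h n)].
by move=> [h e] i; rewrite ltnS leq_eqVlt => /orP[/eqP->|/h].
Qed.

Section hidden_markov_g_measure.
Variables (R : realType) (J K : R) (Q : probability Omega R).
Hypothesis hQ : forall n y, Q (cylinder n y) = (cylinder_weight J K n y)%:E.

(** Both sides are finite measures in D; on n-cylinders each is at most exp ([gfun_rate] n) times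
    the other, and the rate tends to 0. *)
Lemma first_letter_integral a D : measurable D ->
  Q ([set v : Omega | v 0%N = a] `&` shift @^-1` D) =
  (\int[Q]_(v in D) (gfun J K (scons a v))%:E)%E.
Proof.
pose f v := (gfun J K (scons a v))%:E.
have mf : measurable_fun setT f.
  apply/measurable_EFinP; apply: continuous_measurable_Omega.
  exact: continuous_gfun_scons.
have f0 v : (0 <= f v)%E by rewrite lee_fin ltW// gfun_gt0.
pose m1 := fun B => Q ([set v : Omega | v 0%N = a] `&` shift @^-1` B).
pose m2 := fun B => (\int[Q]_(v in B) f v)%E.
have m1s : semi_sigma_additive m1.
  exact: semi_sigma_additive_preimageI measurable_shift (measurable_coordinate 0 a).
have m10 : m1 set0 = 0%E by rewrite /m1 preimage_set0 setI0 measure0.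
have m1p A : (0 <= m1 A)%E by exact: measure_ge0.
have m2s : semi_sigma_additive m2 by exact: semi_sigma_additive_nng_induced.
have m20 : m2 set0 = 0%E by rewrite /m2 integral_set0.
have m2p A : (0 <= m2 A)%E by apply: integral_ge0.
have m1T : (m1 setT < +oo)%E.
  rewrite /m1 preimage_setT setIT (le_lt_trans (probability_le1 _ _)) ?ltry//.
  exact: measurable_coordinate.
have mfin B : measurable B -> m2 B \is a fin_num.
  by move=> mB; apply: integrable_fin_num => //; exact: gfun_scons_integrable.
have m2T : (m2 setT < +oo)%E by rewrite -ge0_fin_numE ?mfin.
pose M1 : {measure set Omega -> \bar R} := HB.pack m1 (isMeasure.Build _ _ _ m1 m10 m1p m1s).
pose M2 : {measure set Omega -> \bar R} := HB.pack m2 (isMeasure.Build _ _ _ m2 m20 m2p m2s).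
have cmp n y := integral_gfun_cylinder_compare J K Q a n y.
have m1E n y : m1 (cylinder n y) = (local_g J K (field_iter J K y n 0) a *
    fine (Q (cylinder n y)))%:E.
  by rewrite /m1 (first_letter_cylinder hQ) (cylinder_fine hQ).
have m2E n y : m2 (cylinder n y) = (fine (m2 (cylinder n y)))%:E.
  by rewrite fineK// mfin//; exact: measurable_cylinder.
apply: (@cylinder_measure_unique _ M1 M2) => // n y.
apply/eqP; rewrite eq_le; apply/andP; split; move: n y.
  apply: (measure_le_of_rate (m1 := M1) (m2 := M2) _ _ (gfun_rate_cvg J K)) => // n y.
  have [_] := cmp n y.
  by rewrite [M1 _]m1E [M2 _]m2E -EFinM lee_fin.
apply: (measure_le_of_rate (m1 := M2) (m2 := M1) _ _ (gfun_rate_cvg J K)) => // n y.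
have [+ _] := cmp n y.
by rewrite [M1 _]m1E [M2 _]m2E -EFinM lee_fin.
Qed.

Lemma hidden_markov_g_measure : is_g_measure Q (gfun J K).
Proof.
have inv := hidden_markov_shift_invariant hQ.
split.
- by split=> //; exact: (hidden_markov_fully_supported hQ).
- exact: continuous_gfun.
- by move=> y; rewrite gfun_gt0 gfun_lt1.
- by move=> y; exact: sum_gfun.
(* This version depends on the future letters only, and at the actual first letter it equals g
   everywhere. *)
exists (fun a y => gfun J K (scons a (shift y))); split; last first.
  by apply/aeW => y; rewrite scons_shift.
move=> a.
have mg : measurable_fun setT (fun v => gfun J K (scons a v)).
  by apply: continuous_measurable_Omega; exact: continuous_gfun_scons.
have gint D : measurable D ->
    Q.-integrable D (EFin \o (fun v => gfun J K (scons a (shift v)))).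
  move=> mD; apply: measurable_bounded_integrable => //.
  - by rewrite (le_lt_trans (probability_le1 _ mD))// ltry.
  - by apply: measurable_funTS; apply: measurableT_comp mg measurable_shift.
  - exists 1; split=> // x x1 v _ /=; rewrite ger0_norm ?ltW ?gfun_gt0//.
    exact: lt_trans (gfun_lt1 _ _ _) x1.
split.
- move=> U mU; rewrite sigma_futureE.
  exists ((fun v => gfun J K (scons a v)) @^-1` U) => //.
  by rewrite -[X in measurable X]setTI; exact: mg.
- exact: gint.
move=> B; rewrite sigma_futureE => -[D mD <-].
have mS : measurable (shift @^-1` D).
  by rewrite -[X in measurable X]setTI; exact: measurable_shift.
apply: etrans (first_letter_integral a mD) _; apply/esym.
pose f v := (gfun J K (scons a v))%:E.
apply: (@integral_shift _ Q f D inv mD _ (gint _ mS)).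
exact/measurable_EFinP.
Qed.

Lemma hidden_markov_bowen_gibbs :
  is_bowen_gibbs Q (potential J K) (ln (lambda J K)).
Proof.
split.
- exact: (hidden_markov_fully_supported hQ).
- exact: (hidden_markov_shift_invariant hQ).
- exact: continuous_potential.
exists (expR (gibbs_radius J K)).
  by rewrite -expR0 ler_expR gibbs_radius_ge0.
move=> y n _; rewrite (cylinder_fine hQ).
have := gibbs_estimate J K n y.
rewrite -[X in X / _]lnK ?posrE ?cylinder_weight_gt0// -expRN -expRB !ler_expR.
by rewrite ler_norml.
Qed.

End hidden_markov_g_measure.

(** * Approximation of measurable sets and partitions by finitely many letters *)

Definition determined (n : nat) (A : set Omega) : Prop :=
  forall v u, cylinder n v u -> A v -> A u.

Lemma cylinder_sym n (u v : Omega) : cylinder n v u -> cylinder n u v.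
Proof. by move=> h i ni; rewrite h. Qed.

Lemma determined_mono n m A : (n <= m)%N -> determined n A -> determined m A.
Proof. by move=> nm h v u vu; apply: h => i ni; apply: vu; exact: leq_trans nm. Qed.

Section approximation.
Variables (R : realType) (P : probability Omega R).

Definition approximable (A : set Omega) : Prop :=
  measurable A /\ forall e : R, 0 < e ->
    exists n D, determined n D /\ (P (A `+` D) <= e%:E)%E.

Let measurable_setY (A B : set Omega) : measurable A -> measurable B ->
  measurable (A `+` B).
Proof. by move=> mA mB; rewrite setY_def; apply: measurableU; exact: measurableD. Qed.

Lemma approximable_determined n A : determined n A -> approximable A.
Proof.
move=> dA; split; first exact: measurable_determined dA.
by move=> e e0; exists n, A; split=> //; rewrite setYK measure0 lee_fin ltW.
Qed.

Lemma approximableC A : approximable A -> approximable (~` A).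
Proof.
move=> [mA h]; split; first exact: measurableC.
move=> e /h[n [D [dD le]]]; exists n, (~` D); split.
  by move=> v u vu nDv Du; apply: nDv; exact: dD (cylinder_sym vu) Du.
(* Complementing is symmetric difference with the whole space, so complementing both sets
   cancels. *)
by rewrite -setYTC -(setYTC D) setYA -(setYA _ setT) (setYC setT D) setYA -setYA setYK setY0.
Qed.

Lemma approximableU A B : approximable A -> approximable B -> approximable (A `|` B).
Proof.
move=> [mA hA] [mB hB]; split; first exact: measurableU.
move=> e e0; have e2 : 0 < e / 2 by rewrite divr_gt0.
have [n [D [dD leD]]] := hA _ e2; have [m [E [dE leE]]] := hB _ e2.
exists (maxn n m), (D `|` E); split.
  move=> v u vu [Dv|Ev]; [left|right].
    exact: (determined_mono (leq_maxl n m) dD vu).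
  exact: (determined_mono (leq_maxr n m) dE vu).
have mD := measurable_determined dD; have mE := measurable_determined dE.
apply: (@le_trans _ _ (P ((A `+` D) `|` (B `+` E)))).
  apply: le_measure; rewrite ?inE.
  - by apply: measurable_setY; exact: measurableU.
  - by apply: measurableU; exact: measurable_setY.
  rewrite !setY_def => w [[[]h1 /not_orP[]h2 h3]|[[]h1 /not_orP[]h2 h3]].
  - by left; left.
  - by right; left.
  - by left; right.
  - by right; right.
apply: le_trans.
  by apply: (@measureU2 _ _ _ P); exact: measurable_setY.
by rewrite [e]splitr EFinD leeD.
Qed.

Lemma approximable_bigcup (A : (set Omega)^nat) :
  (forall i, approximable (A i)) -> approximable (\bigcup_i A i).
Proof.
move=> hA.
have mA i := (hA i).1.
have mU : measurable (\bigcup_i A i) by exact: bigcupT_measurable.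
have hB n : approximable (\big[setU/set0]_(i < n) A i).
  elim: n => [|n IH]; last by rewrite big_ord_recr; exact: approximableU.
  by rewrite big_ord0; apply: (@approximable_determined 0).
split=> // e e0; have e2 : 0 < e / 2 by rewrite divr_gt0.
(* The tails decrease to the empty set: half of e pays for a tail, the other half for approximating
   the finite union that is left. *)
pose C n := \bigcup_i A i `\` \big[setU/set0]_(i < n) A i.
have mC n : measurable (C n) by apply: measurableD => //; exact: (hB n).1.
have capC : \bigcap_n C n = set0.
  apply/seteqP; split=> // w h; have [[i _ Aiw] _] := h 0%N I.
  have [_] := h i.+1 I; apply; rewrite big_ord_recr; by right.
have cC : (P \o C) x @[x --> \oo] --> 0%:E.
  rewrite -[0%:E](measure0 P) -capC; apply: nonincreasing_cvg_mu => //.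
  - by rewrite (le_lt_trans (probability_le1 _ (mC 0%N)))// ltry.
  - by rewrite capC.
  - move=> n m nm; apply/subsetPset => w [Uw h]; split=> // hn; apply: h.
    exact: subset_bigsetU nm _ hn.
move/fine_cvgP : cC => [_ /cvgrPdist_le /(_ _ e2)[n _ /(_ n (leqnn n))]].
rewrite /= sub0r normrN => hn.
have Cn : (P (C n) <= (e / 2)%:E)%E.
  have fin : P (C n) \is a fin_num by rewrite fin_num_measure.
  rewrite -(fineK fin) lee_fin; exact: le_trans (ler_norm _) hn.
have [mB /(_ _ e2) [m [D [dD leD]]]] := hB n.
exists m, D; split=> //.
have mD := measurable_determined dD.
apply: (@le_trans _ _ (P (C n `|` (\big[setU/set0]_(i < n) A i `+` D)))).
  apply: le_measure; rewrite ?inE; try exact: measurable_setY.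
    by apply: measurableU => //; exact: measurable_setY.
  rewrite !setY_def => w [[Uw nD]|[Dw nU]].
    have [Bw|nB] := pselect ((\big[setU/set0]_(i < n) A i) w); last by left.
    by right; left.
  right; right; split=> // Bw; apply: nU.
  by rewrite -bigcup_bigsetU_bigcup; exists n => //; exact: subset_bigsetU Bw.
apply: le_trans.
  by apply: (@measureU2 _ _ _ P) => //; exact: measurable_setY.
by rewrite [e]splitr EFinD leeD.
Qed.

Lemma measurable_approximable A : measurable A -> approximable A.
Proof.
suff : @measurable _ Omega `<=` approximable by exact.
rewrite sigma_cylindersE; apply: smallest_sub.
  split=> [|B hB|F hF]; first exact: (@approximable_determined 0).
    by rewrite setTD; exact: approximableC.
  exact: approximable_bigcup.
move=> _ [->|[n [y ->]]]; first exact: (@approximable_determined 0).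
by apply: (@approximable_determined n) => v u vu yv i ni; rewrite vu// yv.
Qed.

Lemma partition_approximation (k : nat) (xi : Omega -> 'I_k) (e : R) :
  (forall i, measurable (xi @^-1` [set i])) -> 0 < e ->
  exists (n : nat) (eta : Omega -> 'I_k),
    (forall v u, cylinder n v u -> eta v = eta u) /\
    (P [set w | xi w != eta w] <= e%:E)%E.
Proof.
case: k xi => [|k] xi mxi e0; first by case: (xi point).
have ek : 0 < e / k.+1%:R by rewrite divr_gt0.
have /choice [N /choice [D hD]] j := (measurable_approximable (mxi j)).2 _ ek.
pose n := (\max_j N j)%N.
have dD j : determined n (D j).
  by apply: determined_mono (hD j).1; rewrite /n (leq_bigmax j).
(* Off the symmetric differences, w lies in [D j] exactly for j = xi w, so the choice is forced to
   be xi w; elsewhere any label is allowed. *)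
pose eta w := odflt ord0 [pick j | `[< D j w >]].
have eta_det v u : cylinder n v u -> eta v = eta u.
  move=> vu; congr odflt; apply: eq_pick => j; apply/asboolP/asboolP.
    exact: dD vu.
  exact: dD (cylinder_sym vu).
exists n, eta; split=> //.
have meta j : measurable (eta @^-1` [set j]).
  by apply: (@measurable_determined n) => v u vu /= <-; rewrite (eta_det _ _ vu).
have mS j : measurable (xi @^-1` [set j] `+` D j).
  by apply: measurable_setY => //; exact: measurable_determined (dD j).
have mne : measurable [set w | xi w != eta w].
  rewrite (_ : [set w | _] =
      \big[setU/set0]_j (xi @^-1` [set j] `&` ~` (eta @^-1` [set j]))).
    apply: bigsetU_measurable => j _; apply: measurableI => //; exact: measurableC.
  apply/seteqP; split=> [w /= /eqP ne|].
    by rewrite (bigD1 (xi w))//=; left; split=> //= /esym.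
  elim/big_ind: _ => [//|A B hA hB w [/hA|/hB]//|j _ w [/= -> h]].
  by apply/eqP => /esym.
have bound : measurable (\big[setU/set0]_j (xi @^-1` [set j] `+` D j)) /\
    (P (\big[setU/set0]_j (xi @^-1` [set j] `+` D j)) <=
      \sum_(j < k.+1) (e / k.+1%:R)%:E)%E.
  elim/big_rec2 : _ => [|j x A _ [mA leA]]; first by rewrite measure0.
  split; first exact: measurableU.
  apply: le_trans; first by apply: (@measureU2 _ _ _ P).
  by rewrite leeD// (hD j).2.
have e1 : (\sum_(j < k.+1) (e / k.+1%:R)%:E = e%:E)%E.
  by rewrite sumEFin sumr_const card_ord -[_ *+ _]mulr_natr divfK// pnatr_eq0.
rewrite -e1; apply: le_trans bound.2.
apply: le_measure; rewrite ?inE//; first exact: bound.1.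
move=> w /= ne; apply: contrapT => h.
have hj j : D j w <-> xi w = j.
  have {}h : ~ (xi @^-1` [set j] `+` D j) w.
    by move=> hw; apply: h; rewrite (bigD1 j)//=; left.
  move: h; rewrite setY_def => h; split=> [Dj|xj].
    by apply: contrapT => nx; apply: h; right.
  by apply: contrapT => nD; apply: h; left.
move/eqP : ne; apply; rewrite /eta; case: pickP => [j /asboolP/hj//|/(_ (xi w))].
by move/asboolP; case; apply/hj.
Qed.

End approximation.

(** * Gibbs' inequality and means of bounded or finite-valued functions *)

(** For m > 0 this is ln t <= t - 1 at t = q / m, multiplied by m. *)
Lemma mulr_ln_le (R : realType) (m q : R) : 0 <= m -> 0 < q ->
  m * ln q - m * ln m <= q - m.
Proof.
rewrite le_eqVlt => /orP[/eqP<-|m0] q0; first by rewrite !mul0r !subr0 ltW.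
have qm : 0 < q / m by rewrite divr_gt0.
rewrite -mulrBr -ln_div ?posrE//.
have := ler_wpM2l (ltW m0) (le_ln1Dx (_ : -1 < q / m - 1)).
rewrite addrCA subrr addr0 mulrBr mulr1 mulrCA divff ?gt_eqF// mulr1; apply.
by lra.
Qed.

(* The first inequality of the proof is the monotonicity of entropy under
   refinement of a partition, the second one is Gibbs' inequality. *)
Lemma gibbs_inequality (R : realType) (I I' : finType) (m q : I -> I' -> R) :
  (forall c u, 0 <= m c u) -> (forall c u, 0 < q c u) ->
  \sum_c \sum_u q c u <= \sum_c \sum_u m c u ->
  \sum_c - ((\sum_u m c u) * ln (\sum_u m c u)) <=
  \sum_c \sum_u m c u * - ln (q c u).
Proof.
move=> m0 q0 qm.
apply: (@le_trans _ _ (\sum_c \sum_u - (m c u * ln (m c u)))).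
  apply: ler_sum => c _; rewrite mulr_suml -sumrN; apply: ler_sum => u _.
  have := m0 c u; rewrite lerN2 le_eqVlt => /orP[/eqP<-|mu]; first by rewrite !mul0r.
  have le : m c u <= \sum_u m c u.
    by rewrite (bigD1 u)//= lerDl sumr_ge0.
  by rewrite ler_pM2l// ler_ln// posrE// (lt_le_trans mu).
rewrite -subr_ge0 -sumrB.
apply: (@le_trans _ _ (\sum_c \sum_u m c u - \sum_c \sum_u q c u)).
  by rewrite subr_ge0.
rewrite -sumrB; apply: ler_sum => c _; rewrite -!sumrB; apply: ler_sum => u _.
by have := mulr_ln_le (m0 c u) (q0 c u); lra.
Qed.

Section finite_valued.
Variables (R : realType) (d : measure_display) (T : measurableType d).
Variable P : probability T R.

Definition bounded_measurable (f : T -> R) : Prop :=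
  measurable_fun setT f /\ exists M, forall w, `|f w| <= M.

Lemma bounded_measurable_integrable f : bounded_measurable f ->
  P.-integrable setT (EFin \o f).
Proof.
move=> [mf [M fM]]; apply: measurable_bounded_integrable => //.
  by rewrite (le_lt_trans (probability_le1 _ measurableT))// ltry.
by exists M; split; [exact: num_real|move=> x Mx w _; exact: le_trans (fM w) (ltW Mx)].
Qed.

Lemma bounded_measurableD f g : bounded_measurable f -> bounded_measurable g ->
  bounded_measurable (f \+ g).
Proof.
move=> [mf [M fM]] [mg [M' gM]]; split; first exact: measurable_funD.
by exists (M + M') => w; apply: le_trans (ler_normD _ _) (lerD (fM w) (gM w)).
Qed.

Lemma bounded_measurableZ f c : bounded_measurable f ->
  bounded_measurable (fun w => c * f w).
Proof.
move=> [mf [M fM]]; split; first exact: measurable_funM.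
by exists (`|c| * M) => w; rewrite normrM ler_wpM2l.
Qed.

Lemma bounded_measurable_cst c : bounded_measurable (fun=> c).
Proof. by split; [exact: measurable_cst|exists `|c|]. Qed.

Lemma bounded_measurable_sum n (f : nat -> T -> R) :
  (forall i, bounded_measurable (f i)) ->
  bounded_measurable (fun w => \sum_(i < n) f i w).
Proof.
move=> hf; elim: n => [|n IH].
  by under eq_fun do rewrite big_ord0; exact: bounded_measurable_cst.
by under eq_fun do rewrite big_ord_recr; exact: bounded_measurableD.
Qed.

Lemma mean_D f g : bounded_measurable f -> bounded_measurable g ->
  \int[P]_w (f w + g w) = \int[P]_w f w + \int[P]_w g w.
Proof. by move=> hf hg; apply: RintegralD => //; exact: bounded_measurable_integrable. Qed.

Lemma mean_Z f c : bounded_measurable f ->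
  \int[P]_w (c * f w) = c * \int[P]_w f w.
Proof. by move=> hf; apply: RintegralZl => //; exact: bounded_measurable_integrable. Qed.

Lemma mean_cst c : \int[P]_(w in setT) c = c.
Proof. by have := Rintegral_cst P measurableT c; rewrite /cst /= probability_setT mulr1. Qed.

Lemma mean_sum n (f : nat -> T -> R) : (forall i, bounded_measurable (f i)) ->
  \int[P]_w (\sum_(i < n) f i w) = \sum_(i < n) \int[P]_w f i w.
Proof.
move=> hf; elim: n => [|n IH].
  rewrite big_ord0 -[RHS](mean_cst 0); congr (Rintegral _ _ _).
  by apply/funext => w; rewrite big_ord0.
rewrite big_ord_recr /= -IH -mean_D//; last exact: bounded_measurable_sum.
by congr (Rintegral _ _ _); apply/funext => w; rewrite big_ord_recr.
Qed.

Lemma mean_le f g : bounded_measurable f -> bounded_measurable g ->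
  (forall w, f w <= g w) -> \int[P]_w f w <= \int[P]_w g w.
Proof.
by move=> hf hg fg; apply: le_Rintegral => //; exact: bounded_measurable_integrable.
Qed.

Variables (I : finType) (N : T -> I).
Hypothesis mN : forall i, measurable (N @^-1` [set i]).

Lemma bounded_measurable_finite (f : I -> R) : bounded_measurable (fun w => f (N w)).
Proof.
split.
  move=> _ U mU; rewrite setTI.
  rewrite (_ : _ @^-1` U = \big[setU/set0]_(i | `[< U (f i) >]) (N @^-1` [set i])).
    by apply: bigsetU_measurable => i _; exact: mN.
  apply/seteqP; split=> [w Uw|].
    by rewrite (bigD1 (N w)) /=; [left|apply/asboolP].
  by elim/big_ind: _ => [//|A B hA hB w [/hA|/hB]//|i /asboolP Ui w /= ->].
exists (\sum_i `|f i|) => w; rewrite (bigD1 (N w))//= lerDl.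
exact: sumr_ge0.
Qed.

Lemma mean_finite (f : I -> R) :
  \int[P]_w f (N w) = \sum_i fine (P (N @^-1` [set i])) * f i.
Proof.
have E w : f (N w) = \sum_i f i * \1_(N @^-1` [set i]) w.
  rewrite (bigD1 (N w))//= indicE mem_set// mulr1 big1 ?addr0// => i ne.
  rewrite indicE memNset ?mulr0// => /= e; by rewrite e eqxx in ne.
have iint i : P.-integrable setT (fun w => (f i)%:E * (\1_(N @^-1` [set i]) w)%:E)%E.
  by apply: integrableZl => //; apply: integrable_indic; rewrite ?setTI.
rewrite /Rintegral.
have -> : (\int[P]_w (f (N w))%:E =
    \sum_i \int[P]_w ((f i)%:E * (\1_(N @^-1` [set i]) w)%:E))%E.
  rewrite -integral_sum//; apply: eq_integral => w _.
  by rewrite E -sumEFin; apply: eq_bigr => i _; rewrite EFinM.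
rewrite (eq_bigr (fun i => (fine (P (N @^-1` [set i])) * f i)%:E)) ?sumEFin// => i _.
rewrite integralZl//; last by apply: integrable_indic; rewrite ?setTI.
by rewrite integral_indic// setIT EFinM fineK ?fin_num_measure// muleC.
Qed.

Lemma sum_finite_law : \sum_i fine (P (N @^-1` [set i])) = 1.
Proof.
have := mean_finite (fun=> 1); rewrite mean_cst => ->.
by apply: eq_bigr => i _; rewrite mulr1.
Qed.

End finite_valued.

Local Opaque cylinder_weight gibbs_radius potential lambda.

(** * The entropy of a partition bounded by a mean code length *)

Definition word (n : nat) (w : Omega) : {ffun 'I_n -> bool} := [ffun i : 'I_n => w i].

(** The padding is arbitrary: only the first n letters are ever consulted. *)
Definition unword (n : nat) (u : {ffun 'I_n -> bool}) : Omega :=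
  fun i => if insub i is Some j then u j else false.

Lemma wordK n w : cylinder n w (unword (word n w)).
Proof. by move=> i ni; rewrite /unword insubT ffunE. Qed.

Lemma word_fiber n u : @word n @^-1` [set u] = cylinder n (unword u).
Proof.
apply/seteqP; split=> [w <- i ni|w h]; first by rewrite wordK.
by apply/ffunP => i; rewrite ffunE h// /unword valK.
Qed.

Lemma measurable_word n u : measurable (@word n @^-1` [set u]).
Proof. by rewrite word_fiber; exact: measurable_cylinder. Qed.

Definition name (k : nat) (xi : Omega -> 'I_k) (n : nat) (w : Omega) :
  {ffun 'I_n -> 'I_k} := [ffun i : 'I_n => xi (iter i shift w)].
Arguments name {k} xi n w.

Lemma name_fiber k (xi : Omega -> 'I_k) n (c : {ffun 'I_n -> 'I_k}) :
  [set t | forall i : 'I_n, xi (iter i shift t) = c i] = name xi n @^-1` [set c].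
Proof.
apply/seteqP; split=> [w h|w <- i]; last by rewrite ffunE.
by apply/ffunP => i; rewrite ffunE.
Qed.

Lemma measurable_name k (xi : Omega -> 'I_k) n (c : {ffun 'I_n -> 'I_k}) :
  (forall i, measurable (xi @^-1` [set i])) -> measurable (name xi n @^-1` [set c]).
Proof.
move=> mxi; rewrite -name_fiber.
rewrite (_ : [set _ | _] = \bigcap_(i : 'I_n) ((iter i shift) @^-1` (xi @^-1` [set c i]))).
  apply: fin_bigcap_measurable => // i _.
  by rewrite -[X in measurable X]setTI; exact: measurable_iter_shift.
by apply/seteqP; split=> w h i => [_|]; [exact: h|exact: (h i I)].
Qed.

Lemma shift_invariant_iter (R : realType) (P : probability Omega R) (f : Omega -> R) i :
  shift_invariant P -> bounded_measurable f ->
  bounded_measurable (fun w => f (iter i shift w)) /\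
  \int[P]_w f (iter i shift w) = \int[P]_w f w.
Proof.
move=> inv; elim: i f => [//|i IH] f hf.
have hfs : bounded_measurable (fun w => f (shift w)).
  case: hf => [mf [M fM]]; split; last by exists M.
  exact: measurableT_comp mf measurable_shift.
have [b1 e1] := IH _ hfs; split; first exact: b1.
rewrite [LHS]e1 /Rintegral; congr fine.
have := @integral_shift _ P (EFin \o f) setT inv measurableT.
rewrite preimage_setT; apply; first by apply/measurable_EFinP; case: hf.
exact: bounded_measurable_integrable.
Qed.

Section smoothing.
Variables (R : realType) (k : nat) (d : R).
Hypothesis d01 : 0 < d < 1.

(** The law of the true label c when e is predicted: e with weight 1 - d, a uniform label with
    weight d. It is positive everywhere, so its logarithm is bounded. *)
Definition smooth (c e : 'I_k) : R := (1 - d) * (c == e)%:R + d / k%:R.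

Let k0 (c : 'I_k) : 0 < k%:R :> R.
Proof. by rewrite ltr0n (leq_ltn_trans _ (ltn_ord c)). Qed.

Lemma smooth_gt0 c e : 0 < smooth c e.
Proof.
have /andP[d0 d1] := d01; rewrite ltr_wpDl// ?divr_gt0 ?k0//.
by rewrite mulr_ge0// subr_ge0 ltW.
Qed.

Lemma sum_smooth e : \sum_c smooth c e = 1.
Proof.
rewrite big_split /= -big_distrr /= (bigD1 e)//= eqxx big1; last first.
  by move=> i /negbTE ->.
rewrite addr0 mulr1 sumr_const card_ord -[_ *+ _]mulr_natr divfK; first by ring.
by rewrite gt_eqF// k0.
Qed.

Lemma smooth_cost c e :
  - ln (smooth c e) <= - ln (1 - d) + - ln (d / k%:R) * (c != e)%:R.
Proof.
have /andP[d0 d1] := d01; have kp := k0 c.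
have dk : 0 < d / k%:R by rewrite divr_gt0.
have ln1d : ln (1 - d) <= 0 by rewrite ln_le0//; lra.
rewrite /smooth; case: eqP => _ /=; rewrite ?mulr1 ?mulr0 ?addr0 ?add0r.
  rewrite lerN2 ler_ln ?posrE//; lra.
by rewrite lerDr oppr_ge0.
Qed.

End smoothing.

Arguments smooth {R k} d c e.

Lemma bounded_measurable_potential (R : realType) (J K : R) :
  bounded_measurable (potential J K).
Proof.
split; first by apply: continuous_measurable_Omega; exact: continuous_potential.
exists (`|Bfun J 0| + field_radius J K) => w.
have := Bfun_lip J (field J K w 0) 0; rewrite subr0 => h1.
have h2 := field_bound J K w 0.
rewrite -[potential J K w](subrK (Bfun J 0)) addrC.
apply: le_trans (ler_normD _ _) _; rewrite lerD2l.
exact: le_trans h1 h2.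
Qed.

Section entropy_bound.
Variables (R : realType) (J K : R) (Q : probability Omega R).
Hypothesis hQ : forall n y, Q (cylinder n y) = (cylinder_weight J K n y)%:E.
Variables (P : probability Omega R) (inv : shift_invariant P).
Variables (k : nat) (xi eta : Omega -> 'I_k) (m : nat).
Hypothesis mxi : forall i, measurable (xi @^-1` [set i]).
Hypothesis deta : forall v u, cylinder m v u -> eta v = eta u.
Variables (d : R) (n : nat).
Hypothesis d01 : 0 < d < 1.

Let N w := (name xi n w, word (n + m)%N w).
Let mass c u : R := fine (P (N @^-1` [set (c, u)])).
(** The coding law: a word drawn from Q, then independent labels around the predictions. Predicting
    the label at i < n reads m letters from i on, hence words of length n + m. *)
Let q (c : {ffun 'I_n -> 'I_k}) (u : {ffun 'I_(n + m) -> bool}) : R :=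
  cylinder_weight J K (n + m)%N (unword u) *
  \prod_(i < n) smooth d (c i) (eta (iter i shift (unword u))).

Let mN p : measurable (N @^-1` [set p]).
Proof.
case: p => c u.
rewrite (_ : _ @^-1` _ = name xi n @^-1` [set c] `&`
                         @word (n + m)%N @^-1` [set u]).
  by apply: measurableI; [exact: measurable_name|exact: measurable_word].
by apply/seteqP; split=> w /=; [case=> -> ->|case=> <- <-].
Qed.

Let meta i : measurable (eta @^-1` [set i]).
Proof. by apply: (@measurable_determined m) => v u vu /= <-; rewrite (deta vu). Qed.

Lemma name_marginal c : \sum_u mass c u = fine (P (name xi n @^-1` [set c])).
Proof.
have mname c' := measurable_name (n := n) c' mxi.
(* The mean of one indicator is computed twice, from the law of the name and from the law of the
   pair. *)
have := mean_finite P mname (fun c' => (c' == c)%:R).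
rewrite (bigD1 c)//= eqxx mulr1 big1 ?addr0; last first.
  by move=> i /negbTE ->; rewrite mulr0.
move=> <-; have := mean_finite P mN (fun p => (p.1 == c)%:R) => /= ->.
rewrite (eq_bigr (fun p => mass p.1 p.2 * (p.1 == c)%:R)); last by case.
rewrite -(pair_bigA _ (fun c' u => mass c' u * (c' == c)%:R)) /=.
rewrite [RHS](bigD1 c)//= [X in _ + X]big1 ?addr0; last first.
  by move=> i /negbTE ->; rewrite big1// => u _; rewrite mulr0.
by apply: eq_bigr => u _; rewrite eqxx mulr1.
Qed.

(** For a fixed word the sum over names factorises into sums of [smooth], each equal to 1; what
    remains is the law of words under Q. *)
Lemma sum_coding : \sum_c \sum_u q c u = 1.
Proof.
rewrite exchange_big /= -[RHS](sum_finite_law Q (@measurable_word (n + m)%N)).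
apply: eq_bigr => u _; rewrite -big_distrr /=.
rewrite -(bigA_distr_bigA (fun (i : 'I_n) (c : 'I_k) =>
  smooth d c (eta (iter i shift (unword u))))) /=.
rewrite big1 ?mulr1; last by move=> i _; exact: sum_smooth.
by rewrite word_fiber hQ.
Qed.

Lemma coding_cost w : - ln (q (N w).1 (N w).2) <=
  (gibbs_radius J K + (n + m)%:R * ln (lambda J K)) +
  (- 1 * (\sum_(i < (n + m)%N) potential J K (iter i shift w)) +
   \sum_(i < n) (- ln (1 - d) +
     - ln (d / k%:R) * (xi (iter i shift w) != eta (iter i shift w))%:R)).
Proof.
have wK := @wordK (n + m)%N w.
have w0 := cylinder_weight_gt0 J K (n + m)%N w.
have -> : q (N w).1 (N w).2 = cylinder_weight J K (n + m)%N w *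
    \prod_(i < n) smooth d (xi (iter i shift w)) (eta (iter i shift w)).
  (* Both weights are the Q-measure of the same cylinder. *)
  have e : cylinder_weight J K (n + m)%N (unword (word (n + m)%N w)) =
      cylinder_weight J K (n + m)%N w.
    by rewrite -2!(cylinder_fine hQ) (cylinderW wK).
  rewrite /q; change (N w).2 with (word (n + m)%N w); change (N w).1 with (name xi n w).
  rewrite e; apply: f_equal.
  apply: eq_bigr => i _; rewrite ffunE; apply: f_equal.
  apply: deta => j jm.
  have ij : (i + j < n + m)%N by exact: leq_add (ltn_ord i) (ltnW jm).
  by rewrite iter_shiftE [RHS]iter_shiftE -(wK _ ij).
have p0 : 0 < \prod_(i < n) smooth d (xi (iter i shift w)) (eta (iter i shift w)).
  by rewrite prodr_gt0// => i _; exact: smooth_gt0.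
have lnprod : - ln (\prod_(i < n) smooth d (xi (iter i shift w)) (eta (iter i shift w))) <=
   \sum_(i < n) (- ln (1 - d) +
     - ln (d / k%:R) * (xi (iter i shift w) != eta (iter i shift w))%:R).
  rewrite [in leLHS](eq_bigr (fun i : 'I_n =>
    expR (ln (smooth d (xi (iter i shift w)) (eta (iter i shift w)))))); last first.
    by move=> i _; rewrite lnK// posrE smooth_gt0.
  rewrite -expR_sum expRK -sumrN; apply: ler_sum => i _.
  exact: smooth_cost.
rewrite lnM ?posrE//.
have := gibbs_estimate J K (n + m)%N w.
move: lnprod; set a := ln _; set b := \sum_(i < n) _; set c := ln _; set e := \sum_(i < _) _.
by rewrite ler_norml => ? /andP[? ?]; lra.
Qed.

(** Gibbs' inequality for the pair of name and word, followed by integration of [coding_cost];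
    invariance turns each Birkhoff sum into its length times a mean. *)
Lemma join_entropy_le : join_entropy P shift xi n <=
  gibbs_radius J K + (n + m)%:R * (ln (lambda J K) - \int[P]_w potential J K w) +
  n%:R * (- ln (1 - d) + - ln (d / k%:R) * fine (P [set w | xi w != eta w])).
Proof.
have -> : join_entropy P shift xi n =
    \sum_c - ((\sum_u mass c u) * ln (\sum_u mass c u)).
  by apply: eq_bigr => c _; rewrite /= name_marginal name_fiber.
have q0 c u : 0 < q c u.
  rewrite mulr_gt0 ?cylinder_weight_gt0// prodr_gt0// => i _; exact: smooth_gt0.
have mass0 c u : 0 <= mass c u by rewrite fine_ge0.
apply: le_trans (gibbs_inequality mass0 q0 _) _.
  rewrite sum_coding pair_bigA /=; rewrite -[leLHS](sum_finite_law P mN).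
  by apply: ler_sum => -[c u] _.
rewrite pair_bigA /=.
have := mean_finite P mN (fun p => - ln (q p.1 p.2)).
rewrite [X in _ = X -> _](eq_bigr (fun p => mass p.1 p.2 * - ln (q p.1 p.2))); last by case.
move=> <-.
pose s w : R := - ln (1 - d) + - ln (d / k%:R) * (xi w != eta w)%:R.
pose ne w := xi w != eta w.
have mne b : measurable (ne @^-1` [set b]).
  have h : measurable [set w | xi w = eta w].
    rewrite (_ : [set w | _] =
        \bigcup_(j : 'I_k) (xi @^-1` [set j] `&` eta @^-1` [set j])).
      by apply: fin_bigcup_measurable => // j _; exact: measurableI.
    by apply/seteqP; split=> [w /= e|w [j _ [/= -> ->]]//]; exists (xi w).
  case: b; last first.
    rewrite (_ : _ @^-1` _ = [set w | xi w = eta w])//.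
    apply/seteqP; split=> w /=; rewrite /ne; first by move=> /negbFE/eqP.
    by move=> ->; rewrite eqxx.
  rewrite (_ : _ @^-1` _ = ~` [set w | xi w = eta w]); first exact: measurableC.
  by apply/seteqP; split=> w /=; rewrite /ne => /eqP.
have bne : bounded_measurable (fun w => (ne w)%:R : R).
  exact: (bounded_measurable_finite mne (fun b : bool => b%:R)).
have bs : bounded_measurable s.
  apply: bounded_measurableD; first exact: bounded_measurable_cst.
  exact: bounded_measurableZ.
have es : \int[P]_w s w = - ln (1 - d) + - ln (d / k%:R) * fine (P [set w | xi w != eta w]).
  rewrite mean_D; [|exact: bounded_measurable_cst|exact: bounded_measurableZ].
  rewrite mean_cst mean_Z// (mean_finite P mne (fun b : bool => b%:R)) big_bool /=.
  rewrite mulr1 mulr0 addr0; congr (_ + _ * fine (P _)).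
have bp := bounded_measurable_potential J K.
have si i := shift_invariant_iter i inv bs.
have pi i := shift_invariant_iter i inv bp.
have birkhoff f N' : bounded_measurable f ->
    \int[P]_w (\sum_(i < N') f (iter i shift w)) = N'%:R * \int[P]_w f w.
  move=> bf; rewrite (@mean_sum _ _ _ P N' (fun i w => f (iter i shift w))).
    rewrite (eq_bigr (fun=> \int[P]_w f w)) ?sumr_const ?card_ord ?mulr_natl//.
    by move=> i _; have [_] := shift_invariant_iter i inv bf.
  by move=> i; have [] := shift_invariant_iter i inv bf.
have bS : bounded_measurable (fun w => \sum_(i < (n + m)%N) potential J K (iter i shift w)).
  apply: (@bounded_measurable_sum _ _ _ _ (fun i w => potential J K (iter i shift w))) => i.
  exact: (pi i).1.
have bs' : bounded_measurable (fun w => \sum_(i < n) s (iter i shift w)).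
  apply: (@bounded_measurable_sum _ _ _ _ (fun i w => s (iter i shift w))) => i.
  exact: (si i).1.
have bS' := bounded_measurableZ (- 1) bS.
have bSs := bounded_measurableD bS' bs'.
apply: le_trans (mean_le P (bounded_measurable_finite mN (fun p => - ln (q p.1 p.2)))
   (bounded_measurableD (bounded_measurable_cst _
     (gibbs_radius J K + (n + m)%:R * ln (lambda J K))) bSs) coding_cost) _.
rewrite mean_D//; last exact: bounded_measurable_cst.
rewrite mean_cst [X in _ + X]mean_D// mean_Z// birkhoff// birkhoff// es.
by rewrite -subr_ge0 (_ : _ - _ = 0) //; ring.
Qed.

End entropy_bound.

Lemma join_entropy_ge0 (R : realType) (P : probability Omega R) (k : nat)
    (xi : Omega -> 'I_k) n :
  (forall i, measurable (xi @^-1` [set i])) -> 0 <= join_entropy P shift xi n.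
Proof.
move=> mxi; apply: sumr_ge0 => c _ /=; rewrite name_fiber.
have mc := measurable_name c mxi.
rewrite -mulrN mulr_ge0 ?fine_ge0// oppr_ge0 ln_le0// -lee_fin fineK ?fin_num_measure//.
exact: probability_le1.
Qed.

(** * The variational principle and the equilibrium state *)

Section variational_principle.
Variables (R : realType) (J K : R) (Q : probability Omega R).
Hypothesis hQ : forall n y, Q (cylinder n y) = (cylinder_weight J K n y)%:E.

(** The value that the entropy of an invariant [P] cannot exceed, and that it attains for Q. *)
Let gap (P : probability Omega R) : R :=
  ln (lambda J K) - \int[P]_w potential J K w.

Section upper_bound.
Variables (P : probability Omega R) (inv : shift_invariant P).
Variables (k : nat) (xi : Omega -> 'I_k).
Hypothesis mxi : forall i, measurable (xi @^-1` [set i]).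

Lemma join_entropy_rate e : 0 < e -> exists n0, forall n, (n0 <= n)%N ->
  join_entropy P shift xi n / n%:R <= gap P + e.
Proof.
move=> e0.
have e4 : 0 < e / 4 by rewrite divr_gt0.
(* A correct prediction then costs at most - ln (1 - d) = e / 4 per letter. *)
pose d : R := 1 - expR (- (e / 4)).
have d01 : 0 < d < 1.
  by rewrite /d subr_gt0 expR_lt1 oppr_lt0 e4 /= gtrBl expR_gt0.
have lnd : - ln (1 - d) = e / 4 by rewrite /d subKr expRK opprK.
pose b := - ln (d / k%:R).
(* The cost b of a wrong prediction is fixed by now, so the probability of one can be made small
   against it; adding 1 keeps the divisor positive. *)
have b1 : 0 < `|b| + 1 by rewrite ltr_wpDl.
have e4b : 0 < e / 4 / (`|b| + 1) by rewrite divr_gt0.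
have [m [eta [deta Pne]]] := partition_approximation P mxi e4b.
pose C := gibbs_radius J K + m%:R * gap P.
have H n : join_entropy P shift xi n <= C + n%:R * (gap P + e / 2).
  apply: le_trans (join_entropy_le hQ inv mxi deta n d01) _.
  set x := fine _.
  have x0 : 0 <= x by rewrite fine_ge0.
  have xb : b * x <= e / 4.
    apply: (@le_trans _ _ ((`|b| + 1) * x)).
      by rewrite ler_wpM2r// (le_trans (ler_norm b))// lerDl.
    rewrite mulrC -ler_pdivlMr// -lee_fin fineK//.
    by rewrite ge0_fin_numE// (le_lt_trans Pne)// ltry.
  rewrite lnd -/b natrD -/(gap P) /C.
  have : n%:R * (e / 4 + b * x) <= n%:R * (e / 2).
    by rewrite ler_wpM2l//; lra.
  lra.
(* From this length on, the contribution of C per letter is at most e / 2, the other half of the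
   error. *)
pose n0 := (Num.truncn (`|C| / (e / 2))).+1.
have hn0 : `|C| / (e / 2) < n0%:R by exact: truncnS_gt.
exists n0 => n n0n.
have n_gt0 : 0 < n%:R :> R by rewrite ltr0n (leq_trans _ n0n).
rewrite ler_pdivrMr//; apply: le_trans (H n) _.
have : `|C| <= n%:R * (e / 2).
  rewrite -ler_pdivrMr ?divr_gt0// (le_trans (ltW hn0))// ler_nat//.
by have := ler_norm C; lra.
Qed.

(** Entropies of names are nonnegative, and per letter they eventually stay below the gap plus e. *)
Lemma gap_ge0 : 0 <= gap P.
Proof.
apply/ler_addgt0Pr => e e0; have [n h] := join_entropy_rate e0.
by apply: le_trans (h n (leqnn n)); rewrite divr_ge0// join_entropy_ge0.
Qed.

(* Where the sequence diverges, limn is the default point 0. *)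
Lemma partition_entropy_le : partition_entropy P shift xi <= gap P.
Proof.
have [cv|dv] := pselect (cvgn (fun n => join_entropy P shift xi n / n%:R)); last first.
  by rewrite /partition_entropy (dvgP dv); exact: gap_ge0.
apply/ler_addgt0Pr => e e0; have [n h] := join_entropy_rate e0.
by apply: limr_le => //; exists n.
Qed.

End upper_bound.

Lemma KS_entropy_le P : shift_invariant P -> (KS_entropy P shift <= (gap P)%:E)%E.
Proof.
move=> inv; apply: ge_ereal_sup => _ [k [xi [mxi ->]]].
by rewrite lee_fin partition_entropy_le.
Qed.

Definition first_letter (w : Omega) : 'I_2 := if w 0%N then ord_max else ord0.

Lemma name_first_letter n w :
  name first_letter n @^-1` [set name first_letter n w] = cylinder n w.
Proof.
apply/seteqP; split=> v.
  move=> /= /ffunP h i ni; have := h (Ordinal ni).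
  rewrite !ffunE /first_letter !iter_shiftE addn0 /=.
  by case: (v i); case: (w i).
move=> h /=; apply/ffunP => i.
by rewrite !ffunE /first_letter !iter_shiftE addn0 h.
Qed.

Lemma measurable_first_letter i : measurable (first_letter @^-1` [set i]).
Proof.
by apply: (@measurable_determined 1) => v u vu /= <-; rewrite /first_letter vu.
Qed.

(** The names of this partition are the n-cylinders, so the entropy is the mean of - ln of the
    cylinder weight, to which [gibbs_estimate] applies on both sides. *)
Lemma join_entropy_first_letter n :
  `|join_entropy Q shift first_letter n - n%:R * gap Q| <= gibbs_radius J K.
Proof.
have inv := hidden_markov_shift_invariant hQ.
have mN c := measurable_name (n := n) c measurable_first_letter.
have E : join_entropy Q shift first_letter n =
    \int[Q]_w - ln (cylinder_weight J K n w).
  rewrite /join_entropy.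
  transitivity (\sum_c fine (Q (name first_letter n @^-1` [set c])) *
      - ln (fine (Q (name first_letter n @^-1` [set c])))).
    by apply: eq_bigr => c _; rewrite /= name_fiber mulrN.
  rewrite -(mean_finite Q mN (fun c => - ln (fine (Q (name first_letter n @^-1` [set c]))))).
  congr (Rintegral _ _ _); apply/funext => w.
  by rewrite name_first_letter (cylinder_fine hQ).
have bl : bounded_measurable (fun w => - ln (cylinder_weight J K n w)).
  have := bounded_measurable_finite mN
    (fun c => - ln (fine (Q (name first_letter n @^-1` [set c])))).
  congr bounded_measurable; apply/funext => w.
  by rewrite name_first_letter (cylinder_fine hQ).
have bp := bounded_measurable_potential J K.
(* Upper and lower estimates are [S] at c = [gibbs_radius] and at its opposite. *)
pose S (c : R) w := (n%:R * ln (lambda J K) + c) +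
   - 1 * \sum_(i < n) potential J K (iter i shift w).
have bsum : bounded_measurable (fun w => \sum_(i < n) potential J K (iter i shift w)).
  apply: (@bounded_measurable_sum _ _ _ _ (fun i w => potential J K (iter i shift w))) => i.
  by have [] := shift_invariant_iter i inv bp.
have bS c : bounded_measurable (S c).
  apply: bounded_measurableD; first exact: bounded_measurable_cst.
  exact: bounded_measurableZ.
have eS c : \int[Q]_w S c w = n%:R * gap Q + c.
  rewrite mean_D//; [|exact: bounded_measurable_cst|exact: bounded_measurableZ].
  rewrite mean_cst mean_Z// (@mean_sum _ _ _ Q n (fun i w => potential J K (iter i shift w))).
    rewrite (eq_bigr (fun=> \int[Q]_w potential J K w)) ?sumr_const ?card_ord.
      by rewrite /gap -mulr_natl; ring.
    by move=> i _; have [_] := shift_invariant_iter i inv bp.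
  by move=> i; have [] := shift_invariant_iter i inv bp.
have est w := gibbs_estimate J K n w.
have up : \int[Q]_w - ln (cylinder_weight J K n w) <= n%:R * gap Q + gibbs_radius J K.
  rewrite -eS; apply: mean_le => // w.
  by have := est w; rewrite ler_norml /S => /andP[? ?]; lra.
have lo : n%:R * gap Q + - gibbs_radius J K <= \int[Q]_w - ln (cylinder_weight J K n w).
  rewrite -eS; apply: mean_le => // w.
  by have := est w; rewrite ler_norml /S => /andP[? ?]; lra.
by rewrite E ler_norml; apply/andP; split; lra.
Qed.

Lemma partition_entropy_first_letter : partition_entropy Q shift first_letter = gap Q.
Proof.
apply/cvg_lim => //; apply/cvgrPdist_le => e e0.
pose n0 := (Num.truncn (gibbs_radius J K / e)).+1.
have hn0 : gibbs_radius J K / e < n0%:R by exact: truncnS_gt.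
exists n0 => // n /= n0n.
have n_gt0 : 0 < n%:R :> R by rewrite ltr0n (leq_trans _ n0n).
rewrite distrC.
have -> : join_entropy Q shift first_letter n / n%:R - gap Q =
    (join_entropy Q shift first_letter n - n%:R * gap Q) / n%:R.
  by field; rewrite gt_eqF.
rewrite normrM normfV (gtr0_norm n_gt0) ler_pdivrMr//.
apply: le_trans (join_entropy_first_letter n) _.
rewrite -ler_pdivrMl// mulrC (le_trans (ltW hn0))// ler_nat//.
Qed.

Lemma free_energyE P : free_energy (potential J K) P =
  (KS_entropy P shift + (\int[P]_w potential J K w)%:E)%E.
Proof.
rewrite /free_energy fineK// integrable_fin_num//.
exact: bounded_measurable_integrable (bounded_measurable_potential J K).
Qed.

Lemma free_energy_le P : shift_invariant P ->
  (free_energy (potential J K) P <= (ln (lambda J K))%:E)%E.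
Proof.
move=> inv; rewrite free_energyE -[ln _](subrK (\int[P]_w potential J K w)) EFinD.
by rewrite leeD2r// KS_entropy_le.
Qed.

Lemma free_energy_hidden_markov :
  free_energy (potential J K) Q = (ln (lambda J K))%:E.
Proof.
have inv := hidden_markov_shift_invariant hQ.
apply/eqP; rewrite eq_le free_energy_le//=.
rewrite free_energyE -[ln _](subrK (\int[Q]_w potential J K w)) EFinD leeD2r//.
apply: ereal_sup_ubound; exists 2, first_letter; split.
  exact: measurable_first_letter.
by rewrite partition_entropy_first_letter.
Qed.

Lemma hidden_markov_equilibrium : is_equilibrium_state Q (potential J K).
Proof.
have inv := hidden_markov_shift_invariant hQ.
split=> //; first exact: continuous_potential.
apply/eqP; rewrite eq_le; apply/andP; split.
  by apply: ereal_sup_ubound; exists Q.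
rewrite free_energy_hidden_markov.
by apply: ge_ereal_sup => _ [P invP <-]; exact: free_energy_le.
Qed.

End variational_principle.

Local Transparent potential.

Theorem mainTheorem2 (R : realType) (p eps : R)
    (hp : 0 < p < 1) (heps : 0 < eps < 1)
    (d : measure_display) (T : measurableType d) (P : probability T R)
    (X Z : nat -> {RV P >-> bool}) (Y : nat -> T -> bool)
    (hX : is_symmetric_chain P p X)
    (hZ : mutually_independent P Z)
    (hZm1 : forall n, P [set t | spin (Z n t) = -1 :> R] = eps%:E)
    (hZ1 : forall n, P [set t | spin (Z n t) = 1 :> R] = (1 - eps)%:E)
    (hXZ : independent_processes P X Z)
    (hY : forall n t, spin (Y n t) = spin (X n t) * spin (Z n t) :> R)
    (Q : probability Omega R) (hQ : is_law P Y Q) :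
  let J : R := 2^-1 * ln ((1 - p) / p) in
  let K : R := 2^-1 * ln ((1 - eps) / eps) in
  let phi : Omega -> R := fun y => Bfun J (field J K y 0) in
  [/\ forall y i, cvgn (fun n => field_n J K y n i),
      is_g_measure Q (fun y =>
        (lambda J K)^-1 *
        (cosh (field J K y 0) * expR (Bfun J (field J K y 1)) /
         cosh (field J K y 1))),
      is_equilibrium_state Q phi,
      is_bowen_gibbs Q phi (ln (lambda J K)) &
      forall y, phi y =
        2^-1 * ln (4 * sinh (field J K y 0) ^+ 2 + (p * (1 - p))^-1)].
Proof.
move=> J K phi.
have hcyl n y : Q (cylinder n y) = (cylinder_weight J K n y)%:E.
  rewrite hQ; last exact: measurable_cylinder.
  exact: (hidden_markov_cylinder hp heps hX hZ hZm1 hZ1 hXZ hY).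
split.
- exact: is_cvg_field_n.
- exact: (hidden_markov_g_measure hcyl).
- exact: (hidden_markov_equilibrium hcyl).
- exact: (hidden_markov_bowen_gibbs hcyl).
- by move=> y; exact: Bfun_half_logit.
Qed.
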